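(* Let $(A,A^{*})$ be a Hom-Lie bialgebroid over $M$ and $H:A^{*}\to A$ a bundle map over $M$. Let $\mathrm{graph}(H):=\{H\xi+\xi\mid\xi\in A^{*}\}\subset A\oplus A^{*}$, and equip $E=A\oplus A^*$ with the Hom-Courant algebroid structure $(\varphi,\phi_E,\langle\!\langle\cdot,\cdot\rangle\!\rangle,\odot_E,\rho_E)$ determined by the Hom-Lie bialgebroid $(A,A^* )$. Then $\mathrm{graph}(H)$ is a Hom-Dirac structure on $A\oplus A^{*}$ if and only if there exists a $2$-section $\pi\in\Gamma(\Lambda^{2}A)$ with $\phi_A(\pi)=\pi$ such that $H=\pi^{\sharp}$ and $$d_{A^{*}}\pi+\frac12[\pi,\pi]_{A}=0,$$ where $d_{A^*}$ is the differential of the Hom-Lie algebroid $A^*$ and $[\cdot,\cdot]_A$ is the Hom-Schouten bracket on $A$.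
   Context: All Hom-Lie algebroids are assumed to have an invertible underlying Hom-bundle. Thus a Hom-Lie algebroid $(A,\varphi,\phi_A,[\cdot,\cdot]_A,a_A)$ over a manifold $M$ consists of: a vector bundle $A\to M$; a diffeomorphism $\varphi:M\to M$ (with $\varphi^{*}f:=f\circ\varphi$); an invertible linear map $\phi_A:\Gamma(A)\to\Gamma(A)$ with $\phi_A(fX)=\varphi^*f\cdot\phi_A(X)$; a skew-symmetric $\mathbb R$-bilinear bracket $[\cdot,\cdot]_A$ on $\Gamma(A)$ with $\phi_A[X,Y]_A=[\phi_A(X),\phi_A(Y)]_A$ and the Hom-Jacobi identity $[\phi_A(X),[Y,Z]_A]_A+[\phi_A(Y),[Z,X]_A]_A+[\phi_A(Z),[X,Y]_A]_A=0$; and a bundle map $a_A:A\to\varphi^{!}TM$ (pull-back bundle), where a section $V$ of $\varphi^!TM$ acts on functions by $(V(f))(p)=\langle(df)_{\varphi(p)},V_p\rangle$; such that $[X,fY]_A=\varphi^*f[X,Y]_A+a_A(\phi_A(X))(f)\phi_A(Y)$, $a_A(\phi_A(X))\circ\varphi^*=\varphi^*\circ a_A(X)$ and $a_A([X,Y]_A)\circ\varphi^*=a_A(\phi_A(X))\circ a_A(Y)-a_A(\phi_A(Y))\circ a_A(X)$. $\phi_A^\dagger$ on $\Gamma(A^* )$: $\langle\phi_A^\dagger(\xi),X\rangle:=\varphi^*\langle\xi,\phi_A^{-1}(X)\rangle$; $(\phi_A^\dagger)^\dagger=\phi_A$. $\phi_A$ and $\phi_A^\dagger$ extend to $\Gamma(\Lambda^\bullet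 A)$ and $\Gamma(\Lambda^\bullet A^* )$ multiplicatively, acting as $\varphi^*$ on functions. Differential $d_A:\Gamma(\Lambda^kA^* )\to\Gamma(\Lambda^{k+1}A^* )$: $$(d_A\omega)(X_0,\dots,X_k)=\sum_{i=0}^k(-1)^ia_A(X_i)\big(\omega(\phi_A^{-1}(X_0),\dots,\widehat{\phi_A^{-1}(X_i)},\dots,\phi_A^{-1}(X_k))\big)+\sum_{i<j}(-1)^{i+j}\phi_A^\dagger(\omega)\big([\phi_A^{-1}(X_i),\phi_A^{-1}(X_j)]_A,X_0,\dots,\hat X_i,\dots,\hat X_j,\dots,X_k\big).$$ Interior product with $X\in\Gamma(A)$, $\omega\in\Gamma(\Lambda^mA^* )$: $(\iota_X^A\omega)(X_1,\dots,X_{m-1}):=(\phi_A^\dagger(\omega))(\phi_A(X),X_1,\dots,X_{m-1})$. Lie derivative on $\alpha\in\Gamma(A^* )$: $\langle\mathcal L_X^A\alpha,Y\rangle=a_A(\phi_A(X))\langle\alpha,\phi_A^{-1}(Y)\rangle-\langle\phi_A^\dagger(\alpha),[X,\phi_A^{-1}(Y)]_A\rangle$. Hom-Schouten bracket: the unique bilinear extension $[\cdot,\cdot]_A:\Gamma(\Lambda^kA)\times\Gamma(\Lambda^lA)\to\Gamma(\Lambda^{k+l-1}A)$ of the bracket on $\Gamma(A)$ with $[f,g]_A=0$, $[X,f]_A=a_A(\phi_A(X))(f)$, $[D_1,D_2\wedge D_3]_A=[D_1,D_2]_A\wedge\phi_A(D_3)+(-1)^{(k+1)l}\phi_A(D_2)\wedge[D_1,D_3]_A$,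 $[D_1,D_2]_A=-(-1)^{(k-1)(l-1)}[D_2,D_1]_A$ ($D_1$ of degree $k$, $D_2$ of degree $l$). Hom-Lie bialgebroid $(A,A^* )$: Hom-Lie algebroids $(A,\varphi,\phi_A,[\cdot,\cdot]_A,a_A)$ and $(A^*,\varphi,\phi_A^\dagger,[\cdot,\cdot]_{A^*},a_{A^*})$ on dual bundles such that $d_{A^*}[X,Y]_A=[d_{A^*}X,\phi_A(Y)]_A+[\phi_A(X),d_{A^*}Y]_A$ for all $X,Y\in\Gamma(A)$. The operators $d_{A^*},\iota^{A^*},\mathcal L^{A^*}$ are those of the Hom-Lie algebroid $A^*$ (acting on $\Gamma(\Lambda^\bullet A)$). Hom-Courant algebroid structure on $E=A\oplus A^*$: for $X,Y\in\Gamma(A)$, $\xi,\eta\in\Gamma(A^* )$, $$\phi_E(X+\xi)=\phi_A(X)+\phi_A^\dagger(\xi),\quad\langle\!\langle X+\xi,Y+\eta\rangle\!\rangle=\tfrac12(\langle\xi,Y\rangle+\langle\eta,X\rangle),\quad\rho_E(X+\xi)=a_A(X)+a_{A^*}(\xi),$$ $$(X+\xi)\odot_E(Y+\eta)=\big([X,Y]_A+\mathcal L_\xi^{A^*}Y-\iota_\eta^{A^*}d_{A^*}(\phi_A^{-1}(X))\big)+\big([\xi,\eta]_{A^*}+\mathcal L_X^A\eta-\iota_Y^Ad_A((\phi_A^\dagger)^{-1}(\xi))\big).$$ The Hom-Courant bracket $[\![e_1,e_2]\!]_E:=\frac12(e_1\odot_Ee_2-e_2\odot_Ee_1)$ is then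 $$[\![X+\xi,Y+\eta]\!]_E=\Big([X,Y]_A+\mathcal L_\xi^{A^*}Y-\mathcal L_\eta^{A^*}X+\tfrac12d_{A^*}(\langle X,\eta\rangle-\langle Y,\xi\rangle)\Big)+\Big([\xi,\eta]_{A^*}+\mathcal L_X^A\eta-\mathcal L_Y^A\xi-\tfrac12d_A(\langle X,\eta\rangle-\langle Y,\xi\rangle)\Big).$$ A subbundle $L\subset E$ is a Hom-Dirac structure if it is maximally isotropic for $\langle\!\langle\cdot,\cdot\rangle\!\rangle$, integrable ($\Gamma(L)$ is closed under $[\![\cdot,\cdot]\!]_E$) and $\phi_E$-invariant ($\phi_E(\Gamma(L))\subset\Gamma(L)$). For $\pi\in\Gamma(\Lambda^2A)$, $\pi^\sharp:A^*\to A$ is given by $\langle\pi^\sharp\alpha,\beta\rangle=\pi(\alpha,\beta)$, with $(X\wedge Y)(\alpha,\beta)=\langle\alpha,X\rangle\langle\beta,Y\rangle-\langle\alpha,Y\rangle\langle\beta,X\rangle$. *)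

(* Defs.v *)
From HB Require Import structures.
From mathcomp Require Import all_boot all_order all_algebra.
From mathcomp Require Import all_classical all_reals all_analysis.

Set Implicit Arguments.
Unset Strict Implicit.
Unset Printing Implicit Defensive.

Import Order.TTheory GRing.Theory Num.Theory.
Import numFieldNormedType.Exports.

Local Open Scope classical_set_scope.
Local Open Scope ring_scope.

Section Ck.
Variables (R : realType) (n : nat).

(* [U] is meant to be open; the values of [f] outside [U] are irrelevant. *)
Fixpoint Ck (k : nat) (U : set 'rV[R]_n) (f : 'rV[R]_n -> R) : Prop :=
  match k with
  | 0 => forall x, U x -> {for x, continuous f}
  | k'.+1 => (forall x, U x -> differentiable f x) /\
             forall v, Ck k' U (fun x => 'D_v f x)
  end.

Definition Cinf (U : set 'rV[R]_n) (f : 'rV[R]_n -> R) : Prop :=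
  forall k, Ck k U f.

End Ck.

Section CkTheory.
Variable R : realType.

Lemma differentiable_near_eq (n : nat) (f g : 'rV[R]_n -> R) x :
  (\forall y \near x, f y = g y) -> differentiable f x -> differentiable g x.
Proof.
move=> fg df.
have -> : g = f + (g - f) by rewrite addrC subrK.
apply: differentiableD => //.
have h0 : \forall y \near x, (g - f) y = 0.
  by move: fg; apply: filter_app; near=> y => e; rewrite /GRing.add /= /GRing.opp /= e subrr.
set h := g - f in h0 *.
have hx0 : h x = 0 by exact: nbhs_singleton h0.
have hE : h \o shift x = cst (h x) + (0 : 'rV[R]_n -> R) +o_ 0 id.
  apply/eqaddoP => e e0.
  have h1 : \forall y \near (0 : 'rV[R]_n), h (y + x) = 0.
    move: h0; rewrite (near_shift 0) /= subr0 => h0. exact: h0.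
  move: h1; apply: filter_app; near=> y => e1.
  rewrite -[X in `|X|]/(h (y + x) - (h x + 0)) e1 hx0 addr0 subr0 normr0.
  by rewrite mulr_ge0 // ltW.
have d0 : 'd h x = (0 : 'rV[R]_n -> R) :> ('rV[R]_n -> R).
  by apply: (@diff_unique _ _ _ _ \0) => //; exact: cst_continuous.
by apply/diff_locallyP; rewrite d0; split => //; exact: cst_continuous.
Unshelve. all: by end_near. Qed.

Lemma open_near (n : nat) (U : set 'rV[R]_n) x :
  open U -> U x -> \forall y \near x, U y.
Proof. by move=> oU Ux; apply: open_nbhs_nbhs. Qed.

Lemma Ck_eq (n k : nat) (U : set 'rV[R]_n) f g : open U ->
  (forall x, U x -> f x = g x) -> Ck k U f -> Ck k U g.
Proof.
move=> oU; elim: k f g => [|k IH] f g fg /=.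
  move=> cf x Ux; suff: g @ x --> f x by rewrite (fg x Ux).
  apply: cvg_trans (cf x Ux); apply: (@near_eq_cvg _ _ (nbhs x)).
  by apply: filterS (open_near oU Ux); exact: fg.
move=> [df dvf]; split=> [x Ux|v].
  apply: differentiable_near_eq (df x Ux).
  by apply: filterS (open_near oU Ux); exact: fg.
apply: IH (dvf v) => x Ux; apply: near_eq_derive.
by apply: filterS (open_near oU Ux); exact: fg.
Qed.

Lemma Ck_local (n k : nat) (U : set 'rV[R]_n) f :
  (forall x, U x -> exists V, [/\ open V, V x & Ck k V f]) -> Ck k U f.
Proof.
elim: k f => [|k IH] f /= fU.
  by move=> x /fU [V [_ Vx]]; apply.
split=> [x /fU [V [_ Vx [df _]]]|v]; first exact: df.
by apply: IH => x /fU [V [oV Vx [_ dvf]]]; exists V.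
Qed.

Lemma Ck_sub (n k : nat) (U V : set 'rV[R]_n) f :
  V `<=` U -> Ck k U f -> Ck k V f.
Proof.
move=> VU; elim: k f => [|k IH] f /=; first by move=> cf x /VU; exact: cf.
by move=> [df dvf]; split=> [x /VU|v]; [exact: df|exact: IH].
Qed.

Lemma CkW (n k : nat) (U : set 'rV[R]_n) f : Ck k.+1 U f -> Ck k U f.
Proof.
elim: k f => [|k IH] f [df dvf].
  by move=> x /df; exact: differentiable_continuous.
by split=> // v; exact: IH.
Qed.

Lemma Ck_cst (n k : nat) (U : set 'rV[R]_n) (c : R) : Ck k U (fun=> c).
Proof.
elim: k c => [|k IH] c /=; first by move=> x _; exact: cst_continuous.
split=> [x _|v]; first exact: differentiable_cst.
have -> : (fun x => 'D_v (fun _ : 'rV[R]_n => c) x) = (fun=> 0).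
  by apply/funext => x; exact: derive_cst.
exact: IH.
Qed.

Lemma CkD (n k : nat) (U : set 'rV[R]_n) f g : open U ->
  Ck k U f -> Ck k U g -> Ck k U (fun x => f x + g x).
Proof.
move=> oU; elim: k f g => [|k IH] f g.
  by move=> cf cg x Ux; apply: continuousD; [exact: cf|exact: cg].
move=> [df dvf] [dg dvg]; split=> [x Ux|v].
  by apply: differentiableD; [exact: df|exact: dg].
apply: Ck_eq (IH _ _ (dvf v) (dvg v)) => // x Ux.
by rewrite (@deriveD _ _ _ f g) //; apply: diff_derivable; [exact: df|exact: dg].
Qed.

Lemma CkM (n k : nat) (U : set 'rV[R]_n) f g : open U ->
  Ck k U f -> Ck k U g -> Ck k U (fun x => f x * g x).
Proof.
move=> oU; elim: k f g => [|k IH] f g.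
  by move=> cf cg x Ux; apply: continuousM; [exact: cf|exact: cg].
move=> Ckf Ckg; have [df dvf] := Ckf; have [dg dvg] := Ckg.
split=> [x Ux|v].
  by apply: differentiableM; [exact: df|exact: dg].
apply: Ck_eq (CkD oU (IH _ _ (CkW Ckf) (dvg v)) (IH _ _ (CkW Ckg) (dvf v))) => //.
move=> x Ux.
by rewrite (@deriveM _ _ f g) //; apply: diff_derivable; [exact: df|exact: dg].
Qed.

Lemma Ck_sum (I : Type) (s : seq I) (n k : nat) (U : set 'rV[R]_n)
    (f : I -> 'rV[R]_n -> R) :
  open U -> (forall i, Ck k U (f i)) -> Ck k U (fun x => \sum_(i <- s) f i x).
Proof.
move=> oU fk; elim: s => [|i s IH].
  by apply: Ck_eq (@Ck_cst n k U 0) => // x _; rewrite big_nil.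
by apply: Ck_eq (CkD oU (fk i) IH) => // x _; rewrite big_cons.
Qed.

Lemma row_as_sum (n m : nat) (F : 'rV[R]_n -> 'rV[R]_m) :
  F = \sum_j (fun x => F x 0 j *: (delta_mx 0 j : 'rV[R]_m)).
Proof. by apply/funext => x; rewrite fct_sumE; exact: row_sum_delta. Qed.

Lemma differentiable_row (n m : nat) (F : 'rV[R]_n -> 'rV[R]_m) x :
  (forall j, differentiable (fun y => F y 0 j) x) -> differentiable F x.
Proof.
move=> dF; rewrite (row_as_sum F); apply: differentiable_sum => j.
exact: differentiableZl.
Qed.

Lemma continuous_row (n m : nat) (F : 'rV[R]_n -> 'rV[R]_m) x :
  (forall j, {for x, continuous (fun y => F y 0 j)}) -> {for x, continuous F}.
Proof.
move=> cF; suff: F @ x --> F x by [].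
rewrite [X in _ --> X]row_sum_delta {1}(row_as_sum F) fct_sumE.
apply: (@cvg_big _ _ _ _ _ _ _ (nbhs x) _ _ _ (nbhs_filter x)) => [|j _].
  exact: add_continuous.
by apply: cvgZr_tmp; exact: cF.
Qed.

Lemma diff_coord (m : nat) (x v : 'rV[R]_m) j :
  'd (fun M : 'rV[R]_m => M 0 j) x v = v 0 j.
Proof.
have @f : {linear 'rV[R]_m -> R}.
  by exists (fun N : 'rV[R]_m => N 0 j); do 2![eexists]; do ?[constructor];
     rewrite ?mxE// => ? *; rewrite ?mxE//; move=> ?; rewrite !mxE.
rewrite (_ : (fun _ => _) = f) // diff_lin //; exact: coord_continuous.
Qed.

Lemma Ck_comp (n m k : nat) (U : set 'rV[R]_n) (V : set 'rV[R]_m)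
    (F : 'rV[R]_n -> 'rV[R]_m) f :
  open U -> (forall x, U x -> V (F x)) ->
  (forall j, Ck k U (fun x => F x 0 j)) -> Ck k V f ->
  Ck k U (fun x => f (F x)).
Proof.
move=> oU UV; elim: k f => [|k IH] f CF Cf.
  move=> x Ux; apply: continuous_comp; last exact/Cf/UV.
  by apply: continuous_row => j; exact: CF.
have [df dvf] := Cf.
have dF x : U x -> differentiable F x.
  by move=> Ux; apply: differentiable_row => j; have [+ _] := CF j; exact.
split=> [x Ux|v]; first by apply: differentiable_comp; [exact: dF|exact/df/UV].
apply: (@Ck_eq _ _ _ (fun x => \sum_j 'D_v (fun y => F y 0 j) x
                                  * 'D_(delta_mx 0 j) f (F x))) => //.
  move=> x Ux; rewrite (deriveE _ (differentiable_comp (dF x Ux) (df _ (UV _ Ux)))).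
  have dfF := df _ (UV _ Ux); rewrite (diff_comp (dF x Ux) dfF) /=.
  rewrite [X in 'd f _ X]row_sum_delta linear_sum; apply: eq_bigr => j _.
  have dFj : differentiable (fun y => F y 0 j) x by have [+ _] := CF j; exact.
  rewrite linearZ /= (deriveE _ dfF) (deriveE _ dFj); congr (_ * _).
  by rewrite (diff_comp (dF x Ux) (differentiable_coord (F x) 0 j)) /= diff_coord.
apply: Ck_sum => // j; apply: CkM => //; first by have [_ +] := CF j; exact.
by apply: (IH (fun y => 'D_(delta_mx 0 j) f y)) => [j'|]; [exact/CkW/CF|exact: dvf].
Qed.

End CkTheory.

Section Manifold.
Variables (R : realType) (n : nat).

Record chart (T : topologicalType) := Chart {
  cdom : set T;
  ccod : set 'rV[R]_n;
  cmap : T -> 'rV[R]_n;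
  cinv : 'rV[R]_n -> T;
  cdom_open : open cdom;
  ccod_open : open ccod;
  cmap_ccod : forall p, cdom p -> ccod (cmap p);
  cinv_cdom : forall x, ccod x -> cdom (cinv x);
  cmapK : forall p, cdom p -> cinv (cmap p) = p;
  cinvK : forall x, ccod x -> cmap (cinv x) = x;
  cmap_continuous : forall p, cdom p -> {for p, continuous cmap};
  cinv_continuous : forall x, ccod x -> {for x, continuous cinv}
}.

Record manifold := Manifold {
  mcarrier :> topologicalType;
  atlas : set (chart mcarrier);
  manifold_hausdorff : hausdorff_space mcarrier;
  manifold_second_countable : @second_countable mcarrier;
  atlas_cover : forall p, exists2 c, atlas c & cdom c p;
  atlas_compat : forall c c', atlas c -> atlas c' -> forall j,
    Cinf (ccod c `&` cinv c @^-1` cdom c') (fun x => cmap c' (cinv c x) 0 j)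
}.

Definition smooth_on (M : manifold) (U : set M) (f : M -> R) : Prop :=
  forall c, atlas c -> Cinf (ccod c `&` cinv c @^-1` U) (f \o cinv c).

End Manifold.

Arguments cdom_open {R n T} c.
Arguments ccod_open {R n T} c.

Section SmoothFunctions.
Variables (R : realType) (n : nat) (M : manifold R n).
Implicit Types (U V : set M) (f g : M -> R).

Lemma chart_preimage_open (T : topologicalType) (c : chart R n T) (U : set T) :
  open U -> open (ccod c `&` cinv c @^-1` U).
Proof.
move=> oU; rewrite openE => x [cx Ux].
have h1 : nbhs x (ccod c) := open_near (ccod_open c) cx.
have h2 : nbhs x (cinv c @^-1` U).
  by apply: (cinv_continuous cx); apply: open_nbhs_nbhs.
exact: filterI h1 h2.
Qed.

Lemma smooth_on_eq U f g : open U ->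
  (forall p, U p -> f p = g p) -> smooth_on U f -> smooth_on U g.
Proof.
move=> oU fg sf c ac k; apply: Ck_eq (sf c ac k); first exact: chart_preimage_open.
by move=> x [_ Ux] /=; exact: fg.
Qed.

Lemma smooth_on_sub U V f : V `<=` U -> smooth_on U f -> smooth_on V f.
Proof.
by move=> VU sf c ac k; apply: Ck_sub (sf c ac k) => x [cx Vx]; split=> //; exact: VU.
Qed.

Lemma smooth_on_local U f :
  (forall p, U p -> exists V, [/\ open V, V p & smooth_on V f]) -> smooth_on U f.
Proof.
move=> loc c ac k; apply: Ck_local => x [cx /loc [V [oV Vx sf]]].
exists (ccod c `&` cinv c @^-1` V); split=> //; first exact: chart_preimage_open.
exact: sf.
Qed.

Lemma smooth_on_cst U (a : R) : smooth_on U (fun=> a).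
Proof. by move=> c ac k; exact: Ck_cst. Qed.

Lemma smooth_onD U f g : open U ->
  smooth_on U f -> smooth_on U g -> smooth_on U (fun p => f p + g p).
Proof.
by move=> oU sf sg c ac k; apply: CkD; [exact: chart_preimage_open|exact: sf|exact: sg].
Qed.

Lemma smooth_onM U f g : open U ->
  smooth_on U f -> smooth_on U g -> smooth_on U (fun p => f p * g p).
Proof.
by move=> oU sf sg c ac k; apply: CkM; [exact: chart_preimage_open|exact: sf|exact: sg].
Qed.

Lemma smooth_on_sum (I : Type) (s : seq I) U (f : I -> M -> R) : open U ->
  (forall i, smooth_on U (f i)) -> smooth_on U (fun p => \sum_(i <- s) f i p).
Proof.
move=> oU sf c ac k.
by apply: Ck_sum => [|i]; [exact: chart_preimage_open|exact: sf].
Qed.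

Definition smooth : {pred M -> R} := [pred f | `[< smooth_on setT f >]].

Lemma smoothP f : reflect (smooth_on setT f) (f \in smooth).
Proof. exact: asboolP. Qed.

Lemma smooth_subring_closed : subring_closed smooth.
Proof.
split=> [|f g /smoothP sf /smoothP sg|f g /smoothP sf /smoothP sg].
- by apply/smoothP; exact: smooth_on_cst.
- apply/smoothP; apply: (@smooth_on_eq _ (fun p => f p + -1 * g p)) => [|p _|].
  + exact: openT.
  + by rewrite mulN1r.
  by apply: smooth_onD; [exact: openT|exact: sf|
    apply: smooth_onM; [exact: openT|exact: smooth_on_cst|exact: sg]].
- by apply/smoothP; apply: smooth_onM; [exact: openT|exact: sf|exact: sg].
Qed.

HB.instance Definition _ := GRing.isSubringClosed.Build _ smooth
  smooth_subring_closed.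

End SmoothFunctions.

Arguments smooth {R n} M.

Record Cinfty (R : realType) (n : nat) (M : manifold R n) :=
  MkCinfty { cfun :> M -> R; cfunP : cfun \in smooth M }.

HB.instance Definition _ (R : realType) (n : nat) (M : manifold R n) :=
  [isSub for @cfun R n M].
HB.instance Definition _ (R : realType) (n : nat) (M : manifold R n) :=
  [Choice of Cinfty M by <:].
HB.instance Definition _ (R : realType) (n : nat) (M : manifold R n) :=
  GRing.SubChoice_isSubComPzRing.Build _ (smooth M) (Cinfty M)
    (@smooth_subring_closed R n M).

Section CinftyTheory.
Variables (R : realType) (n : nat) (M : manifold R n).

Definition mk_cfun (f : M -> R) (sf : smooth_on setT f) : Cinfty M :=
  MkCinfty (introT (smoothP f) sf).

Lemma cfun_smooth (f : Cinfty M) : smooth_on setT f.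
Proof. by apply/smoothP; exact: cfunP. Qed.

Lemma cfun_inj (f g : Cinfty M) : f =1 g -> f = g.
Proof. by move=> fg; apply/val_inj/funext. Qed.

Definition csm (a : R) : Cinfty M := mk_cfun (smooth_on_cst setT a).

End CinftyTheory.

Section SmoothMaps.
Variables (R : realType) (m n : nat) (M : manifold R m) (N : manifold R n).

Definition smooth_map (F : M -> N) : Prop :=
  continuous F /\
  forall c c', atlas c -> atlas c' -> forall j,
    Cinf (ccod c `&` cinv c @^-1` (F @^-1` cdom c'))
         (fun x => cmap c' (F (cinv c x)) 0 j).

Lemma smooth_on_comp (F : M -> N) (f : N -> R) :
  smooth_map F -> smooth_on setT f -> smooth_on setT (f \o F).
Proof.
move=> [cF sF] sf c ac k; apply: Ck_local => x [cx _].
have [c' ac' c'x] := atlas_cover (F (cinv c x)).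
have oV : open (F @^-1` cdom c').
  by apply: open_comp (cdom_open c') => y _; exact: cF.
exists (ccod c `&` cinv c @^-1` (F @^-1` cdom c')).
split=> //; first exact: chart_preimage_open.
apply: (@Ck_eq _ _ _ _ (fun y => (f \o cinv c') (cmap c' (F (cinv c y))))).
- exact: chart_preimage_open.
- by move=> y [_ c'y] /=; rewrite cmapK.
apply: Ck_comp (sf c' ac' k) => [||j]; first exact: chart_preimage_open.
- by move=> y [_ c'y]; split=> //; exact: cmap_ccod.
- exact: sF.
Qed.

End SmoothMaps.

Record diffeo (R : realType) (n : nat) (M : manifold R n) := Diffeo {
  dmap :> M -> M;
  dmap_inv : M -> M;
  dmapK : cancel dmap dmap_inv;
  dmap_invK : cancel dmap_inv dmap;
  dmap_smooth : smooth_map dmap;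
  dmap_inv_smooth : smooth_map dmap_inv
}.

Definition pull (R : realType) (n : nat) (M : manifold R n) (phi : diffeo M)
    (f : Cinfty M) : Cinfty M :=
  mk_cfun (smooth_on_comp (dmap_smooth phi) (cfun_smooth f)).

(* A vector bundle of rank [r] given by its fibres and an atlas of local       *)
(* frames whose changes of frame are smooth.                                   *)
Record vbundle (R : realType) (n : nat) (M : manifold R n) (r : nat) := VBundle {
  fiber :> M -> vectType R;
  vb_index : Type;
  vb_dom : vb_index -> set M;
  vb_frame : vb_index -> forall p, r.-tuple (fiber p);
  vb_dom_open : forall i, open (vb_dom i);
  vb_cover : forall p, exists i, vb_dom i p;
  vb_frame_basis : forall i p, vb_dom i p -> basis_of fullv (vb_frame i p);
  vb_compat : forall i j a b, smooth_on (vb_dom i `&` vb_dom j)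
    (fun p => coord (vb_frame i p) a (tnth (vb_frame j p) b))
}.

Section Sections.
Variables (R : realType) (n : nat) (M : manifold R n) (r : nat).
Variable A : vbundle M r.

Definition smooth_sec_on (U : set M) (s : forall p, A p) : Prop :=
  forall (i : vb_index A) a,
    smooth_on (U `&` vb_dom i) (fun p => coord (vb_frame i p) a (s p)).

Record section := Section {
  sec :> forall p, A p;
  sec_smooth : smooth_sec_on setT sec
}.

HB.instance Definition _ := gen_eqMixin section.
HB.instance Definition _ := gen_choiceMixin section.

Lemma sec_inj (X Y : section) : (forall p, X p = Y p) -> X = Y.
Proof.
case: X Y => [s ss] [t st] /= st_eq.
have e : s = t by apply: functional_extensionality_dep.
by subst t; congr Section; exact: Prop_irrelevance.
Qed.

Let oTdom (i : vb_index A) : open (setT `&` vb_dom i).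
Proof. by rewrite setTI; exact: vb_dom_open. Qed.

Lemma sec0_subproof : smooth_sec_on setT (fun p => 0).
Proof.
move=> i a; apply: (@smooth_on_eq _ _ _ _ (fun=> 0)) => // [p _|].
  by rewrite linear0.
exact: smooth_on_cst.
Qed.

Lemma secD_subproof (X Y : section) : smooth_sec_on setT (fun p => X p + Y p).
Proof.
move=> i a.
apply: (@smooth_on_eq _ _ _ _
  (fun p => coord (vb_frame i p) a (X p) + coord (vb_frame i p) a (Y p))) => // [p _|].
  by rewrite linearD.
by apply: smooth_onD => //; exact: sec_smooth.
Qed.

Lemma secZ_subproof (f : Cinfty M) (X : section) :
  smooth_sec_on setT (fun p => f p *: X p).
Proof.
move=> i a.
apply: (@smooth_on_eq _ _ _ _
  (fun p => f p * coord (vb_frame i p) a (X p))) => // [p _|].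
  by rewrite linearZ.
apply: smooth_onM => //; last exact: sec_smooth.
by apply: smooth_on_sub (cfun_smooth f).
Qed.

Definition sec0 : section := Section sec0_subproof.
Definition secD (X Y : section) : section := Section (secD_subproof X Y).
Definition secZ (f : Cinfty M) (X : section) : section :=
  Section (secZ_subproof f X).
Definition secN (X : section) : section := secZ (-1) X.

Lemma secDA : associative secD.
Proof. by move=> X Y Z; apply: sec_inj => p /=; rewrite addrA. Qed.
Lemma secDC : commutative secD.
Proof. by move=> X Y; apply: sec_inj => p /=; rewrite addrC. Qed.
Lemma sec0D : left_id sec0 secD.
Proof. by move=> X; apply: sec_inj => p /=; rewrite add0r. Qed.
Lemma secND : left_inverse sec0 secN secD.
Proof. by move=> X; apply: sec_inj => p /=; rewrite scaleN1r addNr. Qed.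

HB.instance Definition _ :=
  GRing.isZmodule.Build section secDA secDC sec0D secND.

Lemma secZA (f g : Cinfty M) (X : section) : secZ f (secZ g X) = secZ (f * g) X.
Proof. by apply: sec_inj => p /=; rewrite scalerA. Qed.
Lemma sec1Z : left_id (1 : Cinfty M) secZ.
Proof. by move=> X; apply: sec_inj => p /=; rewrite scale1r. Qed.
Lemma secZDr : right_distributive secZ +%R.
Proof. by move=> f X Y; apply: sec_inj => p /=; rewrite scalerDr. Qed.
Lemma secZDl (X : section) : {morph secZ^~ X : f g / f + g}.
Proof. by move=> f g; apply: sec_inj => p /=; rewrite scalerDl. Qed.

HB.instance Definition _ := GRing.Zmodule_isLmodule.Build (Cinfty M) section
  secZA sec1Z secZDr secZDl.

End Sections.

Section DualBundle.
Variables (R : realType) (n : nat) (M : manifold R n) (r : nat).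
Variable A : vbundle M r.

Definition dual_frame (i : vb_index A) (p : M) : r.-tuple 'Hom(A p, R^o) :=
  [tuple linfun (coord (vb_frame i p) a : A p -> R^o) | a < r].

Lemma coord_frame_sum (i : vb_index A) p (v : A p) : vb_dom i p ->
  v = \sum_a coord (vb_frame i p) a v *: tnth (vb_frame i p) a.
Proof.
move=> ip; under eq_bigr => a _ do rewrite (tnth_nth 0).
by apply: coord_basis (memvf v); exact: vb_frame_basis.
Qed.

Lemma coord_frame (i : vb_index A) p a b : vb_dom i p ->
  coord (vb_frame i p) a (tnth (vb_frame i p) b) = (a == b)%:R.
Proof.
move=> /vb_frame_basis /basis_free fr.
by rewrite (tnth_nth 0) coord_free // eq_sym.
Qed.

Lemma dual_frameE (i : vb_index A) p a v :
  tnth (dual_frame i p) a v = coord (vb_frame i p) a v.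
Proof. by rewrite tnth_mktuple lfunE. Qed.

Lemma dual_frame_sum (i : vb_index A) p (xi : 'Hom(A p, R^o)) : vb_dom i p ->
  xi = \sum_a xi (tnth (vb_frame i p) a) *: tnth (dual_frame i p) a.
Proof.
move=> ip; apply/lfunP => v; rewrite {1}(coord_frame_sum v ip) linear_sum sum_lfunE.
apply: eq_bigr => a _; rewrite linearZ scale_lfunE dual_frameE.
exact: mulrC.
Qed.

Lemma dual_frame_basis (i : vb_index A) p : vb_dom i p -> basis_of fullv (dual_frame i p).
Proof.
move=> ip; rewrite /basis_of; apply/andP; split.
  rewrite eqEsubv subvf /=; apply/subvP => xi _.
  rewrite (dual_frame_sum xi ip); apply: memv_suml => a _; apply: memvZ.
  by apply: memv_span; exact: mem_tnth.
apply/freeP => k k0 b.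
have {}k0 : \sum_a k a *: tnth (dual_frame i p) a = 0.
  by rewrite -[RHS]k0; apply: eq_bigr => a _; rewrite (tnth_nth 0).
have := congr1 (fun f : 'Hom(A p, R^o) => f (tnth (vb_frame i p) b)) k0.
rewrite /= sum_lfunE zero_lfunE (bigD1 b) //= big1 => [|a ab].
  by rewrite addr0 scale_lfunE dual_frameE coord_frame // eqxx [_ *: _]mulr1.
by rewrite scale_lfunE dual_frameE coord_frame // (negbTE ab) scaler0.
Qed.

Lemma coord_dual_frame (i : vb_index A) p a (xi : 'Hom(A p, R^o)) : vb_dom i p ->
  coord (dual_frame i p) a xi = xi (tnth (vb_frame i p) a).
Proof.
move=> ip; have fr := basis_free (dual_frame_basis ip).
rewrite [in LHS](dual_frame_sum xi ip) linear_sum (bigD1 a) //= big1 => [|b ba].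
  by rewrite addr0 linearZ /= [tnth (dual_frame i p) _](tnth_nth 0) coord_free // eqxx mulr1.
by rewrite linearZ /= [tnth (dual_frame i p) _](tnth_nth 0) coord_free //
  (negbTE ba) mulr0.
Qed.

Lemma dual_frame_compat (i j : vb_index A) a b : smooth_on (vb_dom i `&` vb_dom j)
  (fun p => coord (dual_frame i p) a (tnth (dual_frame j p) b)).
Proof.
apply: (@smooth_on_eq _ _ _ _
    (fun p => coord (vb_frame j p) b (tnth (vb_frame i p) a))) => [|p [ip jp]|].
- by apply: openI; exact: vb_dom_open.
- by rewrite coord_dual_frame // dual_frameE.
by rewrite setIC; exact: vb_compat.
Qed.

Definition dual_bundle : vbundle M r :=
  VBundle (@vb_dom_open _ _ _ _ A) (@vb_cover _ _ _ _ A)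
          dual_frame_basis dual_frame_compat.

Lemma pairing_subproof (xi : section dual_bundle) (X : section A) :
  smooth_on setT (fun p => xi p (X p) : R).
Proof.
apply: smooth_on_local => p _; have [i ip] := vb_cover A p.
exists (vb_dom i); split=> //; first exact: vb_dom_open.
apply: (@smooth_on_eq _ _ _ _ (fun q => \sum_a
   coord (vb_frame i q) a (X q) * coord (dual_frame i q) a (xi q))) => [|q iq|].
- exact: vb_dom_open.
- rewrite [in RHS](coord_frame_sum (X q) iq) linear_sum; apply: eq_bigr => a _.
  by rewrite linearZ coord_dual_frame.
apply: smooth_on_sum => [|a]; first exact: vb_dom_open.
apply: smooth_onM; first exact: vb_dom_open.
  by have := sec_smooth X i a; rewrite setTI.
by have := @sec_smooth _ _ _ _ dual_bundle xi i a; rewrite setTI.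
Qed.

Definition pairing (xi : section dual_bundle) (X : section A) : Cinfty M :=
  mk_cfun (pairing_subproof xi X).

End DualBundle.

Record bmap (R : realType) (n : nat) (M : manifold R n) (r s : nat)
    (A : vbundle M r) (B : vbundle M s) := BMap {
  bmap_fun :> forall p, 'Hom(A p, B p);
  bmap_smooth : forall (U : set M) (X : forall p, A p), open U ->
    smooth_sec_on U X -> smooth_sec_on U (fun p => bmap_fun p (X p))
}.

(* Tangent vectors are derivations of the algebra of smooth functions; the     *)
(* value of [v] at [f] is <(df)_q, v>.                                         *)
Record tangent (R : realType) (n : nat) (M : manifold R n) (q : M) := Tangent {
  tdir :> Cinfty M -> R;
  tdir_linear : forall (a : R) (f g : Cinfty M),
    tdir (csm M a * f + g) = a * tdir f + tdir g;
  tdir_leibniz : forall f g : Cinfty M,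
    tdir (f * g) = f q * tdir g + g q * tdir f
}.

(* Bundle maps from [A] to the pull-back bundle [phi^! TM].  A section of      *)
(* [phi^! TM] is smooth when it maps smooth functions to smooth functions.     *)
Record anchor (R : realType) (n : nat) (M : manifold R n) (phi : diffeo M)
    (r : nat) (A : vbundle M r) := Anchor {
  anchor_fun :> forall p, A p -> tangent (phi p);
  anchor_linear : forall p (a : R) (u v : A p) (f : Cinfty M),
    anchor_fun (a *: u + v) f = a * anchor_fun u f + anchor_fun v f;
  anchor_smooth : forall (U : set M) (X : forall p, A p) (f : Cinfty M), open U ->
    smooth_sec_on U X -> smooth_on U (fun p => anchor_fun (X p) f)
}.

(* The action of the section [a X] of [phi^! TM] on functions. *)
Definition anchor_act (R : realType) (n : nat) (M : manifold R n) (phi : diffeo M)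
    (r : nat) (A : vbundle M r) (a : anchor phi A) (X : section A)
    (f : Cinfty M) : Cinfty M :=
  mk_cfun (anchor_smooth a f openT (sec_smooth X)).

Record hom_lie_algebroid (R : realType) (n : nat) (M : manifold R n)
    (phi : diffeo M) (r : nat) (A : vbundle M r) := HomLieAlgebroid {
  twist : section A -> section A;
  twist_inv : section A -> section A;
  twistK : cancel twist twist_inv;
  twist_invK : cancel twist_inv twist;
  twistD : {morph twist : X Y / X + Y};
  twistZ : forall (f : Cinfty M) X, twist (f *: X) = pull phi f *: twist X;
  lbr : section A -> section A -> section A;
  lbr_skew : forall X Y, lbr X Y = - lbr Y X;
  lbr_linear : forall (a : R) X Y Z,
    lbr X (csm M a *: Y + Z) = csm M a *: lbr X Y + lbr X Z;
  twist_lbr : {morph twist : X Y / lbr X Y};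
  hom_jacobi : forall X Y Z,
    lbr (twist X) (lbr Y Z) + lbr (twist Y) (lbr Z X)
      + lbr (twist Z) (lbr X Y) = 0;
  anch : anchor phi A;
  lbr_leibniz : forall X (f : Cinfty M) Y,
    lbr X (f *: Y) = pull phi f *: lbr X Y + anchor_act anch (twist X) f *: twist Y;
  anch_twist : forall X f,
    anchor_act anch (twist X) (pull phi f) = pull phi (anchor_act anch X f);
  anch_lbr : forall X Y f,
    anchor_act anch (lbr X Y) (pull phi f)
      = anchor_act anch (twist X) (anchor_act anch Y f) - anchor_act anch (twist Y) (anchor_act anch X f)
}.

Section Forms.
Variables (R : realType) (n : nat) (M : manifold R n) (r : nat).
Variable A : vbundle M r.

(* A section of Lambda^k A^* is an alternating C^oo(M)-multilinear function of *)
(* [k] sections of [A].  It is encoded as a function of sequences of sections  *)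
(* that vanishes on the sequences whose size is not [k], so that no transport  *)
(* between equal degrees is needed.                                            *)
Definition kform : Type := seq (section A) -> Cinfty M.

Definition is_kform (k : nat) (w : kform) : Prop :=
  [/\ forall s, size s != k -> w s = 0,
      forall s1 s2 (f : Cinfty M) X Y,
        w (s1 ++ (f *: X + Y) :: s2) = f * w (s1 ++ X :: s2) + w (s1 ++ Y :: s2)
    & forall s1 s2 s3 X, w (s1 ++ X :: s2 ++ X :: s3) = 0].

Definition kform_scale (f : Cinfty M) (w : kform) : kform := fun s => f * w s.

Definition kform_of_fun (f : Cinfty M) : kform :=
  fun s => if s is [::] then f else 0.

Definition kform_of_covec (xi : section (dual_bundle A)) : kform :=
  fun s => if s is [:: X] then pairing xi X else 0.

(* number of pairs [i < j] of positions with [~~ m`_i] and [m`_j] *)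
Fixpoint mask_inversions (m : bitseq) : nat :=
  if m is b :: m' then ((~~ b) * count id m' + mask_inversions m')%N else 0.

(* The sum over (k, l)-shuffles; [m] marks the arguments given to [v].  With   *)
(* this normalisation (X ^ Y)(a, b) = <a, X><b, Y> - <a, Y><b, X>.             *)
Definition kwedge (v w : kform) : kform := fun s =>
  \sum_(m : (size s).-tuple bool)
     (-1) ^+ mask_inversions m * (v (mask m s) * w (mask (map negb m) s)).

End Forms.

Arguments kform_of_fun {R n M r} A f.

(* The identification of [Gamma(A)] with the sections of Lambda^1 (A^* )^*. *)
Definition kform_of_vec (R : realType) (n : nat) (M : manifold R n) (r : nat)
    (A : vbundle M r) (X : section A) : kform (dual_bundle A) :=
  fun s => if s is [:: xi] then pairing xi X else 0.

(* The inverse identifications.  When [w] is a 1-form, the section below exists  *)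
(* and is unique; the default value of [xget] is only used for other [w].      *)
Definition vec_of_kform (R : realType) (n : nat) (M : manifold R n) (r : nat)
    (A : vbundle M r) (w : kform (dual_bundle A)) : section A :=
  xget 0 [set X | kform_of_vec X = w].

Definition covec_of_kform (R : realType) (n : nat) (M : manifold R n) (r : nat)
    (A : vbundle M r) (w : kform A) : section (dual_bundle A) :=
  xget 0 [set xi | kform_of_covec xi = w].

Definition rem_at (T : Type) (i : nat) (s : seq T) : seq T :=
  take i s ++ drop i.+1 s.

Section Calculus.
Variables (R : realType) (n : nat) (M : manifold R n) (phi : diffeo M) (r : nat).
Variables (A : vbundle M r) (L : hom_lie_algebroid phi A).

(* The extension of phi_A^dagger to forms; on functions it is phi^*. *)
Definition dagger (w : kform A) : kform A :=
  fun s => pull phi (w (map (twist_inv L) s)).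

Definition algd_diff (w : kform A) : kform A := fun s =>
  \sum_(i < size s) (-1) ^+ i *
     anchor_act (anch L) s`_i (w (map (twist_inv L) (rem_at i s))) +
  \sum_(j < size s) \sum_(i < j) (-1) ^+ (i + j) *
     dagger w (lbr L (twist_inv L s`_i) (twist_inv L s`_j)
                 :: rem_at i (rem_at j s)).

Definition interior_product (X : section A) (w : kform A) : kform A :=
  fun s => dagger w (twist L X :: s).

Definition lie_derivative (X : section A) (w : kform A) : kform A :=
  fun s => if s is [:: Y] then
    anchor_act (anch L) (twist L X) (w [:: twist_inv L Y])
      - dagger w [:: lbr L X (twist_inv L Y)]
  else 0.

End Calculus.

(* Hom-Lie algebroids on dual bundles, the twist of [A^*] being phi_A^dagger.  *)
Record hom_lie_pair (R : realType) (n : nat) (M : manifold R n) (phi : diffeo M)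
    (r : nat) (A : vbundle M r) := HomLiePair {
  LA : hom_lie_algebroid phi A;
  LAd : hom_lie_algebroid phi (dual_bundle A);
  twist_dagger : forall xi X,
    pairing (twist LAd xi) X = pull phi (pairing xi (twist_inv LA X))
}.

Section Bialgebroid.
Variables (R : realType) (n : nat) (M : manifold R n) (phi : diffeo M) (r : nat).
Variable A : vbundle M r.

(* The extension of phi_A = (phi_A^dagger)^dagger to multisections of [A]. *)
Definition twist_multi (P : hom_lie_pair phi A) : kform (dual_bundle A) -> kform (dual_bundle A) :=
  dagger (LAd P).

Record is_hom_schouten (P : hom_lie_pair phi A)
    (S : kform (dual_bundle A) -> kform (dual_bundle A) -> kform (dual_bundle A)) : Prop := IsHomSchouten {
  (* the degree of [S f g = 0] for functions [f] and [g] is immaterial *)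
  schouten_form : forall k l D1 D2, is_kform k D1 -> is_kform l D2 ->
    is_kform (k + l).-1 (S D1 D2);
  schouten_linearl : forall k l (a : R) D1 D1' D2,
    is_kform k D1 -> is_kform k D1' -> is_kform l D2 ->
    S (kform_scale (csm M a) D1 + D1') D2
      = kform_scale (csm M a) (S D1 D2) + S D1' D2;
  schouten_linearr : forall k l (a : R) D1 D2 D2',
    is_kform k D1 -> is_kform l D2 -> is_kform l D2' ->
    S D1 (kform_scale (csm M a) D2 + D2')
      = kform_scale (csm M a) (S D1 D2) + S D1 D2';
  schouten_vec : forall X Y : section A,
    S (kform_of_vec X) (kform_of_vec Y) = kform_of_vec (lbr (LA P) X Y);
  schouten_fun : forall f g : Cinfty M,
    S (kform_of_fun (dual_bundle A) f) (kform_of_fun (dual_bundle A) g) = 0;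
  schouten_vec_fun : forall (X : section A) (f : Cinfty M),
    S (kform_of_vec X) (kform_of_fun (dual_bundle A) f)
      = kform_of_fun (dual_bundle A) (anchor_act (anch (LA P)) (twist (LA P) X) f);
  schouten_wedge : forall k l m D1 D2 D3,
    is_kform k D1 -> is_kform l D2 -> is_kform m D3 ->
    S D1 (kwedge D2 D3)
      = kwedge (S D1 D2) (twist_multi P D3)
        + kform_scale ((-1) ^+ (k.+1 * l)) (kwedge (twist_multi P D2) (S D1 D3));
  (* (k - 1) (l - 1) and (k + 1) (l + 1) have the same parity *)
  schouten_skew : forall k l D1 D2, is_kform k D1 -> is_kform l D2 ->
    S D1 D2 = - kform_scale ((-1) ^+ (k.+1 * l.+1)) (S D2 D1)
}.

(* On multisections the Hom-Schouten bracket is determined by [hlb_pair]       *)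
(* through its defining properties, so [schouten] is not additional data.      *)
Record hom_lie_bialgebroid := HomLieBialgebroid {
  hlb_pair :> hom_lie_pair phi A;
  schouten : kform (dual_bundle A) -> kform (dual_bundle A) -> kform (dual_bundle A);
  schoutenP : is_hom_schouten hlb_pair schouten;
  hlb_compat : forall X Y : section A,
    algd_diff (LAd hlb_pair) (kform_of_vec (lbr (LA hlb_pair) X Y))
      = schouten (algd_diff (LAd hlb_pair) (kform_of_vec X))
                 (kform_of_vec (twist (LA hlb_pair) Y))
        + schouten (kform_of_vec (twist (LA hlb_pair) X))
                   (algd_diff (LAd hlb_pair) (kform_of_vec Y))
}.

End Bialgebroid.

Section Courant.
Variables (R : realType) (n : nat) (M : manifold R n) (phi : diffeo M) (r : nat).
Variables (A : vbundle M r) (B : hom_lie_bialgebroid phi A).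

(* E = A (+) A^* *)
Definition courant_fiber (p : M) : vectType R := (A p * dual_bundle A p)%type.
Definition courant_sec : Type := (section A * section (dual_bundle A))%type.

Definition courant_twist (e : courant_sec) : courant_sec :=
  (twist (LA B) e.1, twist (LAd B) e.2).

Definition courant_pairing (p : M) (u v : courant_fiber p) : R :=
  2^-1 * (u.2 v.1 + v.2 u.1).

Definition courant_anchor (e : courant_sec) (f : Cinfty M) : Cinfty M :=
  anchor_act (anch (LA B)) e.1 f + anchor_act (anch (LAd B)) e.2 f.

Definition dorfman (e1 e2 : courant_sec) : courant_sec :=
  let: (X, xi) := e1 in let: (Y, eta) := e2 in
  (lbr (LA B) X Y
     + vec_of_kform (lie_derivative (LAd B) xi (kform_of_vec Y))
     - vec_of_kform (interior_product (LAd B) eta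
         (algd_diff (LAd B) (kform_of_vec (twist_inv (LA B) X)))),
   lbr (LAd B) xi eta
     + covec_of_kform (lie_derivative (LA B) X (kform_of_covec eta))
     - covec_of_kform (interior_product (LA B) Y
         (algd_diff (LA B) (kform_of_covec (twist_inv (LAd B) xi))))).

Definition courant_bracket (e1 e2 : courant_sec) : courant_sec :=
  let d12 := dorfman e1 e2 in let d21 := dorfman e2 e1 in
  (csm M 2^-1 *: (d12.1 - d21.1), csm M 2^-1 *: (d12.2 - d21.2)).

Definition subfamily : Type := forall p : M, {vspace courant_fiber p}.

Definition is_subbundle (L : subfamily) : Prop :=
  exists k : nat, forall p, exists (U : set M)
      (e1 : 'I_k -> forall q, A q) (e2 : 'I_k -> forall q, dual_bundle A q),
    [/\ open U, U p,
        forall i, smooth_sec_on U (e1 i) /\ smooth_sec_on U (e2 i)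
      & forall q, U q ->
          basis_of (L q) [tuple ((e1 i q, e2 i q) : courant_fiber q) | i < k]].

Definition in_sections (L : subfamily) (e : courant_sec) : Prop :=
  forall p, ((e.1 p, e.2 p) : courant_fiber p) \in L p.

Definition isotropic (p : M) (W : {vspace courant_fiber p}) : Prop :=
  forall u v, u \in W -> v \in W -> courant_pairing u v = 0.

Definition maximally_isotropic (L : subfamily) : Prop :=
  forall p, isotropic (L p) /\
    forall W : {vspace courant_fiber p}, isotropic W -> (L p <= W)%VS -> W = L p.

Definition is_hom_dirac (L : subfamily) : Prop :=
  [/\ is_subbundle L,
      maximally_isotropic L,
      forall e1 e2, in_sections L e1 -> in_sections L e2 ->
        in_sections L (courant_bracket e1 e2)
    & forall e, in_sections L e -> in_sections L (courant_twist e)].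

Definition graph_bundle (H : bmap (dual_bundle A) A) : subfamily :=
  fun p => limg (linfun (fun xi : dual_bundle A p => ((H p xi, xi) : courant_fiber p))).

Definition is_sharp (pi : kform (dual_bundle A)) (H : bmap (dual_bundle A) A) : Prop :=
  forall alpha beta : section (dual_bundle A),
    forall p, beta p (H p (alpha p)) = pi [:: alpha; beta] p.

End Courant.

(* Main.v *)
Require Import Defs.
From HB Require Import structures.
From mathcomp Require Import all_boot all_order all_algebra.
From mathcomp Require Import all_classical all_reals all_analysis.
From mathcomp Require Import ring lra zify.

Import Order.TTheory GRing.Theory Num.Theory.
Import numFieldNormedType.Exports.

Local Open Scope classical_set_scope.
Local Open Scope ring_scope.

(** Untwisting reduces the theorem to the classical one for Lie bialgebroids.
    As the twist phi_A is invertible, the bracket phi_A^-1 [X, Y] together with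
    the correspondingly corrected anchor ([ubr], [uact]) satisfies the ordinary
    Leibniz rule, and every Hom-operation of the statement is an ordinary one
    composed with the twist: the differential is d after phi_A^dagger, while the
    Lie derivative, the contraction of a differential, the Schouten bracket and
    the Dorfman product are the ordinary ones followed by the twist.

    At a point, graph(H) is maximally isotropic exactly when H is skew
    ([graph_maximally_isotropic]), that is, when H = pi^sharp for a 2-section
    pi; it is invariant under the twist exactly when pi is.  For such an H,
    graph(H) is closed under the Courant bracket exactly when, for all x and y, the two
    components U and u of the bracket of (H x, x) and (H y, y) satisfy U = H u.
    Pairing U - H u with a third covector z gives [courant_defect], a sum of two
    expressions that are cyclic in x, y, z.  The one that involves the
    algebroid A^* is the formula that defines d pi, and the one that involves A
    is 1/2 [pi, pi] ([maurer_cartan_twist], [pairing_dorfman]).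

    The last identification needs an explicit formula for the Schouten bracket,
    which is known only through its defining properties.  For the bracket of two
    2-sections it is [uS_twosections], obtained from the formulas for the
    bracket of a 2-section with a function and with a vector.  In each of them
    the difference of the two sides is linear over smooth functions in a
    2-section and vanishes on X ^ Y; by [two_section_ind] it then vanishes,
    because a 2-section multiplied by a suitable bump function is a finite sum
    of products of global sections ([two_section_decomp]).

    Bump functions ([exists_bump]) moreover extend every vector to a global
    section, so that identities between global sections control the fibres, and
    they identify the linear functionals on sections with the sections of the
    dual bundle ([represent_covec], [represent_vec]).  The latter shows that the
    Lie derivatives and contractions in the Dorfman product, defined as forms,
    do come from sections. *)

Set Implicit Arguments.
Unset Strict Implicit.
Unset Printing Implicit Defensive.

(** * Smooth functions with prescribed support *)

Section Flat.
Variable R : realType.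

(** The functions t^-m exp(-1/t) are closed under differentiation up to linear
    combinations, so a family in m allows an induction on the order of
    differentiability in which only first derivatives are computed. *)
Definition flat (m : nat) (t : R) : R :=
  if 0 < t then t^-1 ^+ m * expR (- t^-1) else 0.

Lemma flat_gt0 m t : 0 < t -> 0 < flat m t.
Proof. by move=> t0; rewrite /flat t0 mulr_gt0 ?expR_gt0// exprn_gt0// invr_gt0. Qed.

Lemma flat_le0 m t : t <= 0 -> flat m t = 0.
Proof. by rewrite /flat; case: ltP. Qed.

Lemma flat_ge0 m t : 0 <= flat m t.
Proof. by case: (ltP 0 t) => [/(flat_gt0 m)/ltW //|/(flat_le0 m) ->]. Qed.

(** The exponential beats every power: this makes each [flat m] an o(t) at 0,
    hence differentiable there with derivative 0. *)
Lemma flat_le_sqr m t : flat m t <= (m.+2)`!%:R * t ^+ 2.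
Proof.
case: (ltP 0 t) => [t0|/(flat_le0 m) ->]; last first.
  by rewrite mulr_ge0// sqr_ge0.
rewrite /flat t0 expRN ler_pdivrMr ?expR_gt0//.
have u0 : 0 <= t^-1 by rewrite invr_ge0 ltW.
have := expR_ge1Dxn m.+1 u0; set e := expR _ => le_e.
have {}le_e : t^-1 ^+ m.+2 <= (m.+2)`!%:R * e.
  rewrite mulrC -ler_pdivrMr ?ltr0n ?fact_gt0//.
  by apply: le_trans le_e; rewrite lerDr.
rewrite mulrAC -[leLHS](mulfK (_ : t ^+ 2 != 0)) ?expf_neq0 ?gt_eqF// -exprVn.
have -> : t^-1 ^+ m * t ^+ 2 * t^-1 ^+ 2 = t ^+ 2 * t^-1 ^+ m.+2 by rewrite
  !exprS; ring.
rewrite mulrC.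
by apply: ler_wpM2r => //; exact: sqr_ge0.
Qed.

Lemma is_derive_flat m (t : R) :
  is_derive t 1 (flat m) (flat m.+2 t - m%:R * flat m.+1 t).
Proof.
have [t0|t0|->] := ltgtP t 0.
- rewrite !flat_le0 ?ltW// mulr0 subr0.
  apply: (@near_eq_is_derive _ _ _ (cst 0)).
    near=> x; rewrite flat_le0// ltW//; near: x; exact: lt_nbhsl.
- have flatE j : flat j t = t^-1 ^+ j * expR (- t^-1) by rewrite /flat t0.
  rewrite !flatE.
  have tn0 : t != 0 by rewrite gt_eqF.
  have dV : is_derive t 1 (fun x : R => x^-1) (- t ^- 2 *: 1) by exact: is_deriveV.
  have de : is_derive t 1 (expR \o (fun x : R => - x^-1)) (expR (- t^-1) * -
    (- t ^- 2 *: 1)).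
    by apply: is_derive1_comp.
  have dp : is_derive t 1 (fun x : R => x^-1 ^+ m) ((m%:R * t^-1 ^+ m.-1) *
    (- t ^- 2 *: 1)).
    apply: (@is_derive1_comp _ (fun x => x ^+ m)).
    have := @is_deriveX _ _ (@id R) m t^-1 1 1 (is_derive_id _ _).
    by rewrite [_ *: _]mulr1 exprfctE.
  have dM := is_deriveM dp de.
  have nE : \forall x \near t, (fun x : R => x^-1 ^+ m * expR (- x^-1)) x = flat m x.
    near=> x; rewrite /flat; have -> // : 0 < x by near: x; exact: lt_nbhsr.
  apply: is_derive_eq (near_eq_is_derive nE dM) _.
  rewrite /GRing.scale /= -exprVn.
  case: m {dp dM nE} => [|m]; first by rewrite !expr0; ring.
  by rewrite /= !exprS; ring.
- rewrite !flat_le0// mulr0 subr0.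
  suff h : h^-1 *: ((flat m \o shift 0) (h *: 1) - flat m 0) @[h --> 0^'] --> (0 : R).
    by split; [apply/cvg_ex; exists 0|exact: cvg_lim h].
  apply/cvgrPdist_le => e e0.
  have C0 : 0 < (m.+2)`!%:R :> R by rewrite ltr0n fact_gt0.
  near=> h; rewrite sub0r normrN /= addr0 [_ *: 1]mulr1 (@flat_le0 m 0)// subr0.
  have hn0 : h != 0 by near: h; exact: nbhs_dnbhs_neq.
  rewrite normrM normfV ler_pdivrMl ?normr_gt0// ger0_norm ?flat_ge0//.
  apply: le_trans (flat_le_sqr _ _) _; rewrite -real_normK ?num_real// expr2
    mulrA mulrC.
  apply: ler_wpM2l => //; rewrite mulrC -ler_pdivlMr//.
  near: h; apply: nbhs_dnbhs.
  exists (e / (m.+2)`!%:R) => /=; first by rewrite divr_gt0.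
  by move=> h /=; rewrite sub0r normrN => /ltW.
Unshelve. all: by end_near. Qed.

End Flat.

Section CkFlat.
Variable R : realType.

Lemma Ck_flat (n k m : nat) (U : set 'rV[R]_n) f : open U ->
  Ck k U f -> Ck k U (fun x => flat m (f x)).
Proof.
move=> oU; have df t : differentiable (@flat R m) t.
  apply/derivable1_diffP; exact: (@ex_derive _ _ _ _ _ _ _ (is_derive_flat m t)).
elim: k m f df => [|k IH] m f df Cf.
  move=> x Ux; apply: continuous_comp; first exact: Cf.
  exact: differentiable_continuous.
have [dif dvf] := Cf; split=> [x Ux|v].
  by apply: differentiable_comp; [exact: dif|exact: df].
have dfl j t : differentiable (@flat R j) t.
  apply/derivable1_diffP; exact: (@ex_derive _ _ _ _ _ _ _ (is_derive_flat j t)).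
apply: (@Ck_eq _ _ _ _ (fun x => (flat m.+2 (f x) + - m%:R * flat m.+1
  (f x)) * 'D_v f x)) => //.
  move=> x Ux; rewrite (@deriveE _ _ _ (fun y => flat m (f y))); last first.
    exact: differentiable_comp (dif _ Ux) (df _).
  rewrite (diff_comp (dif _ Ux) (df _)) /= diff1E// -deriveE; last exact: dif.
  rewrite derive1E (@derive_val _ _ _ _ _ _ _ (is_derive_flat m (f x))) mulNr.
  by rewrite /GRing.scale /= mulrC.
have Cf' := CkW Cf.
apply: CkM => //; last exact: dvf.
apply: CkD => //; first exact: IH.
by apply: CkM => //; [exact: Ck_cst|exact: IH].
Qed.

(** The derivative of 1/f is again a product of 1/f and derivatives of f, so the
    induction on k closes without computing higher derivatives. *)
Lemma Ck_inv (n k : nat) (U : set 'rV[R]_n) f : open U ->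
  (forall x, U x -> f x != 0) -> Ck k U f -> Ck k U (fun x => (f x)^-1).
Proof.
move=> oU f0; elim: k => [|k IH] Cf.
  by move=> x Ux; apply: continuousV; [exact: f0|exact: Cf].
have [dif dvf] := Cf; split=> [x Ux|v].
  by apply: differentiableV; [exact: dif|exact: f0].
apply: (@Ck_eq _ _ _ _ (fun x => (-1 * (f x)^-1 * (f x)^-1) * 'D_v f x)) => //.
  move=> x Ux; rewrite deriveV ?f0//; last exact/diff_derivable/dif.
  by rewrite /GRing.scale /= -exprVn; ring.
have Ci := IH (CkW Cf).
apply: CkM => //; last exact: dvf.
by do !apply: CkM => //; exact: Ck_cst.
Qed.

Lemma Ck_coord (n k : nat) (U : set 'rV[R]_n) i : Ck k U (fun x => x 0 i).
Proof.
case: k => [|k]; first by move=> x _; exact: coord_continuous.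
split=> [x _|v]; first exact: differentiable_coord.
rewrite (_ : (fun x => _) = fun=> v 0 i); first exact: Ck_cst.
by apply/funext => x; rewrite deriveE ?diff_coord//; exact: differentiable_coord.
Qed.

(** The quotient g1 / (g1 + g2), with g1 positive exactly on the open ball of
    radius e and g2 exactly outside the closed ball of radius e / 2; the two
    regions cover everything, so the denominator never vanishes. *)
Definition plateau (n : nat) (a : 'rV[R]_n) (e : R) (x : 'rV[R]_n) : R :=
  let d := \sum_i (x 0 i - a 0 i) ^+ 2 in
  flat 0 (e ^+ 2 - d) / (flat 0 (e ^+ 2 - d) + flat 0 (d - e ^+ 2 / 4)).

Lemma Ck_plateau n (a : 'rV[R]_n) e k : 0 < e -> Ck k setT (plateau a e).
Proof.
move=> e0; have oT : open [set: 'rV[R]_n] by exact: openT.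
pose d := fun x : 'rV[R]_n => \sum_i (x 0 i - a 0 i) ^+ 2.
have Cd : Ck k setT d.
  apply: Ck_sum => // i.
  have Ci : Ck k setT (fun x : 'rV[R]_n => x 0 i - a 0 i).
    by apply: CkD => //; [exact: Ck_coord|exact: Ck_cst].
  exact: CkM.
have C1 : Ck k setT (fun x => flat 0 (e ^+ 2 - d x)).
  apply: Ck_flat => //; apply: (@Ck_eq _ _ _ _ (fun x => e ^+ 2 + -1 * d x)) => //.
    by move=> x _; rewrite mulN1r.
  by apply: CkD => //; [exact: Ck_cst|apply: CkM => //; exact: Ck_cst].
have C2 : Ck k setT (fun x => flat 0 (d x - e ^+ 2 / 4)).
  by apply: Ck_flat => //; apply: CkD => //; exact: Ck_cst.
apply: CkM => //; apply: Ck_inv => //; last exact: CkD.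
move=> x _; have e20 : 0 < e ^+ 2 by rewrite exprn_gt0.
rewrite gt_eqF//; case: (ltP (d x) (e ^+ 2)) => h.
  by apply: ltr_pwDl; [apply: flat_gt0; rewrite subr_gt0|exact: flat_ge0].
apply: ltr_wpDl; [exact: flat_ge0|apply: flat_gt0; rewrite subr_gt0].
by apply: lt_le_trans h; lra.
Qed.

Lemma plateau_eq1 n (a : 'rV[R]_n) e : 0 < e ->
  \forall x \near a, plateau a e x = 1.
Proof.
move=> e0; have e20 : 0 < e ^+ 2 by rewrite exprn_gt0.
pose d := fun x : 'rV[R]_n => \sum_i (x 0 i - a 0 i) ^+ 2.
have cd : {for a, continuous d}.
  have : Ck 0 setT d.
    apply: Ck_sum => [|i]; first exact: openT.
    have Ci : Ck 0 setT (fun x : 'rV[R]_n => x 0 i - a 0 i).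
      by apply: CkD; [exact: openT|exact: Ck_coord|exact: Ck_cst].
    by apply: CkM => //; exact: openT.
  exact.
have d0 : d a = 0 by rewrite /d big1// => i _; rewrite subrr expr0n.
have : \forall x \near a, d x < e ^+ 2 / 4.
  apply: (cd [set y | y < e ^+ 2 / 4]); apply: (@lt_nbhsl R); rewrite d0; lra.
apply: filterS => x hx; rewrite /plateau -/(d x) (@flat_le0 _ 0 (_ - _ / 4));
  last by rewrite subr_le0 ltW.
rewrite addr0 divff// gt_eqF//; apply: flat_gt0; rewrite subr_gt0.
by apply: lt_trans hx _; lra.
Qed.

(** The vanishing is stated outside a cube, which is compact in any dimension as
    a product of segments. *)
Lemma plateau_eq0 n (a x : 'rV[R]_n) e : 0 < e ->
  ~ (forall i, a 0 i - e <= x 0 i <= a 0 i + e) -> plateau a e x = 0.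
Proof.
move=> e0 /existsNP[i xi]; rewrite /plateau; set d := \sum_i _.
suff /(@flat_le0 R 0) -> : e ^+ 2 - d <= 0 by rewrite mul0r.
rewrite subr_le0 /d (bigD1 i)//= -[leLHS]addr0.
apply: lerD; last by apply: sumr_ge0 => j _; exact: sqr_ge0.
move/negP: xi; rewrite -ler_distlC distrC -ltNge => xi.
rewrite -[leRHS]real_normK ?num_real// lerXn2r// ?nnegrE ?ltW//.
Qed.

End CkFlat.

Section Bump.
Variables (R : realType) (n : nat) (M : manifold R n).

(** The plateau of a chart, extended by 0, is smooth because its support is the
    continuous image of a compact cube and hence closed, the manifold being
    Hausdorff.  Keeping the closed set K in the statement lets later extensions
    by 0 be checked on the two open sets U and the complement of K. *)
Lemma exists_bump (U : set M) (p : M) : open U -> U p ->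
  exists chi : Cinfty M, exists K : set M,
    [/\ \forall q \near p, chi q = 1, closed K, K `<=` U
      & forall q, ~ K q -> chi q = 0].
Proof.
move=> oU Up; have [c ac cp] := atlas_cover p.
pose a := cmap c p; pose W := ccod c `&` cinv c @^-1` U.
have oW : open W by exact: chart_preimage_open.
have Wa : W a by split; [exact: cmap_ccod|rewrite /= /a cmapK].
have /nbhs_ballP[e0 /= e00 eW] : nbhs a W by exact: open_near.
(* half the radius, so that the closed cube lies in the open ball *)
pose e := e0 / 2; have e0' : 0 < e by rewrite divr_gt0.
pose B := [set x : 'rV[R]_n | forall i, x ord0 i \in `[a ord0 i - e, a ord0 i + e]].
have cB : compact B.
  apply: (@rV_compact R n (fun i => `[a ord0 i - e, a ord0 i + e]%classic)).
  by move=> i; exact: segment_compact.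
have BW : B `<=` W.
  move=> x Bx; apply: eW; split => // i j; rewrite ord1 /ball /=.
  have := Bx j; rewrite in_itv /= -ler_distlC => /le_lt_trans -> //.
  by rewrite /e ltr_pdivrMr// ltr_pMr// ltr1n.
pose K := cinv c @` B.
have cK : closed K.
  apply: compact_closed; first exact: manifold_hausdorff.
  apply: continuous_compact cB; apply: continuous_in_subspaceT => x /set_mem Bx.
  by apply: cinv_continuous; case: (BW _ Bx).
pose f q := if pselect (cdom c q) then plateau a e (cmap c q) else 0.
have fK q : ~ K q -> f q = 0.
  move=> Kq; rewrite /f; case: pselect => // cq; apply: plateau_eq0 => // h.
  by apply: Kq; exists (cmap c q); [move=> i; rewrite in_itv /=; exact: h|exact: cmapK].
have sf : smooth_on setT f.
  apply: smooth_on_local => q _; case: (pselect (K q)) => [Kq|Kq].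
    exists (cdom c); split; first exact: cdom_open.
      by case: Kq => x Bx <-; apply: cinv_cdom; case: (BW _ Bx).
    move=> c' ac' k.
    apply: (@Ck_eq _ _ _ _ (fun y => plateau a e (cmap c (cinv c' y)))).
    - exact/chart_preimage_open/cdom_open.
    - by move=> y [_ cy] /=; rewrite /f; case: pselect.
    apply: (@Ck_comp _ _ _ _ _ setT (fun y => cmap c (cinv c' y)) (plateau a e)) => //.
    + exact/chart_preimage_open/cdom_open.
    + by move=> j; exact: atlas_compat.
    + exact: Ck_plateau.
  exists (~` K); split => //; first exact: closed_openC.
  apply: (@smooth_on_eq _ _ _ _ (fun=> 0)); first exact: closed_openC.
    by move=> y /fK.
  exact: smooth_on_cst.
exists (mk_cfun sf), K; split => //.
- have ca : \forall x \near p, plateau a e (cmap c x) = 1.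
    exact: (cmap_continuous cp (plateau_eq1 a e0')).
  have cn : \forall x \near p, cdom c x by apply: open_nbhs_nbhs; split => //;
    exact: cdom_open.
  apply: filterS2 ca cn => x; rewrite /= /f; by case: pselect.
- by move=> _ [x /BW[_ Ux] <-].
Qed.

End Bump.

(** * Global sections and the fibres of a bundle *)

Lemma near_open (T : topologicalType) (p : T) (P : T -> Prop) :
  (\forall q \near p, P q) -> exists V : set T, [/\ open V, V p & V `<=` P].
Proof.
move=> h; have : nbhs p P := h.
by rewrite nbhsE => -[V [oV Vp] VP]; exists V.
Qed.

Section Frames.
Variables (R : realType) (n : nat) (M : manifold R n) (r : nat).
Implicit Types (A : vbundle M r) (p q : M).

Lemma extend_section A (U : set M) (s : forall p, A p) p :
  open U -> U p -> smooth_sec_on U s ->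
  exists X : section A, \forall q \near p, X q = s q.
Proof.
move=> oU Up ss; have [chi [K [chi1 cK KU chi0]]] := exists_bump oU Up.
have st : smooth_sec_on setT (fun q => chi q *: s q : A q).
  move=> i a; apply: smooth_on_local => q [_ iq]; have odi := vb_dom_open i.
  case: (pselect (K q)) => [/KU Uq|Kq].
    exists (U `&` vb_dom i); split; [exact: openI|by []|].
    apply: (@smooth_on_eq _ _ _ _
      (fun x => chi x * coord (vb_frame i x) a (s x))); first exact: openI.
      by move=> x _; rewrite linearZ.
    apply: smooth_onM; [exact: openI| |exact: ss].
    by apply: smooth_on_sub (cfun_smooth chi).
  exists (~` K); split => //; first exact: closed_openC.
  apply: (@smooth_on_eq _ _ _ _ (fun=> 0)); first exact: closed_openC.
    by move=> x /chi0 ->; rewrite scale0r linear0.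
  exact: smooth_on_cst.
by exists (Section st); apply: filterS chi1 => q /= ->; rewrite scale1r.
Qed.

Lemma smooth_frame A (i : vb_index A) b :
  smooth_sec_on (vb_dom i) (fun q => tnth (vb_frame i q) b).
Proof. by move=> j a; rewrite setIC; exact: vb_compat. Qed.

Lemma extend_frame A (i : vb_index A) p : vb_dom i p ->
  exists X : 'I_r -> section A,
    \forall q \near p, forall a, X a q = tnth (vb_frame i q) a.
Proof.
move=> ip; have ex a : exists X : section A,
    \forall q \near p, X q = tnth (vb_frame i q) a.
  exact: extend_section (vb_dom_open i) ip (@smooth_frame A i a).
exists (fun a => projT1 (cid (ex a))); apply: filter_forall => a.
exact: projT2 (cid (ex a)).
Qed.

Lemma sec_sumE A (I : Type) (s : seq I) (P : pred I) (F : I -> section A) p :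
  (\sum_(i <- s | P i) F i) p = \sum_(i <- s | P i) F i p.
Proof. by elim/big_rec2: _ => // i x y _ <-. Qed.

Lemma cfun_sumE (I : Type) (s : seq I) (P : pred I) (F : I -> Cinfty M) p :
  (\sum_(i <- s | P i) F i) p = \sum_(i <- s | P i) F i p.
Proof. by elim/big_rec2: _ => // i x y _ <-. Qed.

Lemma cfunME (f g : Cinfty M) p : (f * g) p = f p * g p. Proof. by []. Qed.

Lemma secZE A (f : Cinfty M) (X : section A) p : (f *: X) p = f p *: X p.
Proof. by []. Qed.

Lemma section_through A p (v : A p) : exists X : section A, X p = v.
Proof.
have [i ip] := vb_cover A p; have [X /nbhs_singleton Xp] := extend_frame ip.
exists (\sum_a csm M (coord (vb_frame i p) a v) *: X a).
rewrite sec_sumE [RHS](coord_frame_sum v ip); apply: eq_bigr => a _.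
by rewrite -Xp.
Qed.

(** A frame near p and its dual frame extend to global sections; after
    multiplication by a bump function supported where they form dual frames, the
    expansion in the frame becomes an identity between global sections, which
    linear operations on sections can be applied to. *)
Lemma local_frame A p : exists (X : 'I_r -> section A)
    (xi : 'I_r -> section (dual_bundle A)) (chi : Cinfty M),
  [/\ \forall q \near p, chi q = 1,
      forall Y, chi *: Y = \sum_a (chi * pairing (xi a) Y) *: X a
    & forall al, chi *: al = \sum_a (chi * pairing al (X a)) *: xi a].
Proof.
have [i ip] := vb_cover A p; have [X Xp] := extend_frame ip.
have [xi xip] := @extend_frame (dual_bundle A) i p ip.
have : \forall q \near p, [/\ vb_dom i q,
    forall a, X a q = tnth (vb_frame i q) a
  & forall a, xi a q = tnth (dual_frame i q) a].
  have di : \forall q \near p, vb_dom i q.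
    by apply: open_nbhs_nbhs; split => //; exact: vb_dom_open.
  by move: di Xp xip; apply: filterS3 => q iq h1 h2.
move=> /near_open[V [oV Vp VP]].
have [chi [K [chi1 _ KV chi0]]] := exists_bump oV Vp.
exists X, xi, chi; split=> // [Y|al]; apply: sec_inj => q; rewrite sec_sumE secZE.
  case: (pselect (K q)) => [/KV/VP[iq Xq xiq]|/chi0 chiq0]; last first.
    by rewrite chiq0 scale0r big1// => a _; rewrite secZE cfunME chiq0 mul0r scale0r.
  rewrite [X in _ *: X](coord_frame_sum (Y q) iq) scaler_sumr.
  by apply: eq_bigr => a _; rewrite scalerA secZE cfunME /= Xq xiq dual_frameE.
case: (pselect (K q)) => [/KV/VP[iq Xq xiq]|/chi0 chiq0]; last first.
  by rewrite chiq0 scale0r big1// => a _; rewrite secZE cfunME chiq0 mul0r scale0r.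
rewrite [X in _ *: X](dual_frame_sum (al q) iq) scaler_sumr.
by apply: eq_bigr => a _; rewrite scalerA secZE cfunME /= Xq xiq.
Qed.

(** A pointwise condition that determines the value and is solved near every
    point by some section is solved globally: uniqueness makes the local
    solutions agree, so smoothness can be read off from any one of them. *)
Lemma glue_section A (Q : forall p, A p -> Prop) :
  (forall p u v, Q p u -> Q p v -> u = v) ->
  (forall p, exists X : section A, \forall q \near p, Q q (X q)) ->
  exists X : section A, forall p, Q p (X p).
Proof.
move=> uQ exQ; pose s p := projT1 (cid (exQ p)).
have sP p : \forall q \near p, Q q (s p q) := projT2 (cid (exQ p)).
have Qs p : Q p (s p p) := nbhs_singleton (sP p).
suff ss : smooth_sec_on setT (fun p => s p p) by exists (Section ss).
move=> i a; apply: smooth_on_local => p [_ ip].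
have [V [oV Vp VP]] := near_open (sP p).
have oW : open (V `&` vb_dom i) by apply: openI => //; exact: vb_dom_open.
exists (V `&` vb_dom i); split => //.
apply: (@smooth_on_eq _ _ _ _ (fun q => coord (vb_frame i q) a (s p q))) => //.
  by move=> q [/VP Vq _]; rewrite (uQ _ _ _ Vq (Qs q)).
by apply: smooth_on_sub (sec_smooth (s p) i a) => q [].
Qed.

End Frames.

Lemma addr_idem0 (V : zmodType) (x : V) : x = x + x -> x = 0.
Proof. by move=> e; apply: (addIr x); rewrite add0r -e. Qed.

Section Representation.
Variables (R : realType) (n : nat) (M : manifold R n) (r : nat).
Variable A : vbundle M r.
Implicit Types (X Y : section A) (xi al : section (dual_bundle A)).

Lemma pairingDl xi al X : pairing (xi + al) X = pairing xi X + pairing al X.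
Proof. by apply: cfun_inj => p; rewrite /= lfunE. Qed.

Lemma pairingZl f xi X : pairing (f *: xi) X = f * pairing xi X.
Proof. by apply: cfun_inj => p; rewrite /= lfunE. Qed.

Lemma pairingDr xi X Y : pairing xi (X + Y) = pairing xi X + pairing xi Y.
Proof. by apply: cfun_inj => p; rewrite /= linearD. Qed.

Lemma pairingZr f xi X : pairing xi (f *: X) = f * pairing xi X.
Proof. by apply: cfun_inj => p; rewrite /= linearZ. Qed.

Lemma fiber_sep p (u v : A p) :
  (forall xi, (xi p : 'Hom(A p, R^o)) u = (xi p : 'Hom(A p, R^o)) v) -> u = v.
Proof.
move=> uv; have [i ip] := vb_cover A p.
rewrite (coord_frame_sum u ip) (coord_frame_sum v ip); apply: eq_bigr => a _.
have [xi xip] := section_through (tnth (dual_frame i p) a : dual_bundle A p).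
by have := uv xi; rewrite xip !dual_frameE => ->.
Qed.

Lemma cofiber_sep p (u v : 'Hom(A p, R^o)) :
  (forall X, u (X p) = v (X p)) -> u = v.
Proof. by move=> uv; apply/lfunP => w; have [X <-] := section_through w. Qed.

Lemma pairing_injr X Y : (forall xi, pairing xi X = pairing xi Y) -> X = Y.
Proof.
move=> XY; apply: sec_inj => p; apply: fiber_sep => xi.
by have := congr1 (fun f : Cinfty M => f p) (XY xi).
Qed.

Section Linear.
Variables (B : vbundle M r) (W : section B -> Cinfty M).
Hypothesis Wlin : forall f (Z1 Z2 : section B), W (f *: Z1 + Z2) = f * W Z1 + W Z2.

Lemma sec_linear0 : W 0 = 0.
Proof.
by apply: addr_idem0; have := Wlin 1 0 0; rewrite scaler0 addr0 mul1r.
Qed.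

Lemma sec_linearZ f (Z : section B) : W (f *: Z) = f * W Z.
Proof. by rewrite -[f *: Z]addr0 Wlin sec_linear0 addr0. Qed.

Lemma sec_linear_sum (I : Type) (s : seq I) (F : I -> section B) :
  W (\sum_(i <- s) F i) = \sum_(i <- s) W (F i).
Proof.
elim: s => [|i s IH]; first by rewrite !big_nil sec_linear0.
by rewrite !big_cons -IH -{1}[F i]scale1r Wlin mul1r.
Qed.
End Linear.

(** Linearity over smooth functions makes W local: by [local_frame], near p it
    is the pairing with the sum of the W(X_a) xi_a. *)
Lemma represent_covec (W : section A -> Cinfty M) :
  (forall f X Y, W (f *: X + Y) = f * W X + W Y) ->
  exists xi : section (dual_bundle A), forall X, pairing xi X = W X.
Proof.
move=> Wlin.
pose Q p (u : dual_bundle A p) := forall X, (u : 'Hom(A p, R^o)) (X p) = W X p.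
have [|p|xi Qxi] := @glue_section _ _ _ _ (dual_bundle A) Q.
- by move=> p u v Qu Qv; apply: cofiber_sep => X; rewrite Qu Qv.
- have [X [xi [chi [chi1 HX _]]]] := local_frame A p.
  exists (\sum_a W (X a) *: xi a); apply: filterS chi1 => q chiq Y.
  rewrite sec_sumE sum_lfunE.
  have := congr1 (fun f : Cinfty M => f q) (sec_linearZ Wlin chi Y).
  rewrite HX (sec_linear_sum Wlin) cfun_sumE cfunME chiq mul1r => <-.
  apply: eq_bigr => a _; rewrite (sec_linearZ Wlin) !cfunME chiq mul1r secZE lfunE /=.
  exact: mulrC.
- by exists xi => X; apply: cfun_inj => p; exact: Qxi.
Qed.

Lemma represent_vec (W : section (dual_bundle A) -> Cinfty M) :
  (forall f xi al, W (f *: xi + al) = f * W xi + W al) ->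
  exists X : section A, forall xi, pairing xi X = W xi.
Proof.
move=> Wlin.
pose Q p (u : A p) := forall xi, (xi p : 'Hom(A p, R^o)) u = W xi p.
have [|p|X QX] := @glue_section _ _ _ _ A Q.
- by move=> p u v Qu Qv; apply: fiber_sep => X; rewrite Qu Qv.
- have [X [xi [chi [chi1 _ HX]]]] := local_frame A p.
  exists (\sum_a W (xi a) *: X a); apply: filterS chi1 => q chiq al.
  rewrite sec_sumE linear_sum.
  have := congr1 (fun f : Cinfty M => f q) (sec_linearZ Wlin chi al).
  rewrite HX (sec_linear_sum Wlin) cfun_sumE cfunME chiq mul1r => <-.
  apply: eq_bigr => a _; rewrite (sec_linearZ Wlin) !cfunME chiq mul1r secZE linearZ /=.
  exact: mulrC.
- by exists X => xi; apply: cfun_inj => p; exact: QX.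
Qed.

End Representation.

(** * The algebra of forms *)

Section FormAlgebra.
Variables (R : realType) (n : nat) (M : manifold R n) (r : nat).
Variable B : vbundle M r.
Implicit Types (f g : Cinfty M) (v w : kform B) (x y z : section B).

Lemma kformP v w : (forall s, v s = w s) -> v = w.
Proof. by move=> vw; apply/funext. Qed.

Lemma kform_scale1 v : kform_scale 1 v = v.
Proof. by apply: kformP => s; rewrite /kform_scale mul1r. Qed.

Lemma kformDE v w s : (v + w) s = v s + w s. Proof. by []. Qed.

Lemma kformNE v s : (- v) s = - v s. Proof. by []. Qed.

Lemma csm1 : csm M 1 = 1. Proof. exact: cfun_inj. Qed.

Lemma is_kform_scaleD k f v w :
  is_kform k v -> is_kform k w -> is_kform k (kform_scale f v + w).
Proof.
move=> [v0 vl va] [w0 wl wa]; split=> [s sk|s1 s2 g X Y|s1 s2 s3 X].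
- by rewrite kformDE /kform_scale v0// w0// mulr0 addr0.
- by rewrite !kformDE /kform_scale vl wl; ring.
- by rewrite kformDE /kform_scale va wa mulr0 addr0.
Qed.

Lemma is_kform0 k : is_kform k (0 : kform B).
Proof. by split=> // *; rewrite mulr0 addr0. Qed.

Lemma is_kform_scale k f v : is_kform k v -> is_kform k (kform_scale f v).
Proof. by move=> kv; rewrite -[kform_scale _ _]addr0;
  apply: is_kform_scaleD => //; exact: is_kform0. Qed.

Lemma is_kform_fun f : is_kform 0 (kform_of_fun B f).
Proof.
split=> [[]//|s1 s2 g X Y|s1 s2 s3 X]; case: s1 => //= *; rewrite ?mulr0 ?addr0//.
Qed.

Definition kform1 (W : section B -> Cinfty M) : kform B :=
  fun s => if s is [:: x] then W x else 0.

Definition kform2 (W : section B -> section B -> Cinfty M) : kform B :=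
  fun s => if s is [:: x; y] then W x y else 0.

Lemma is_kform1 W : (forall f x y, W (f *: x + y) = f * W x + W y) ->
  is_kform 1 (kform1 W).
Proof.
move=> Wl; split=> [[|? []]//|s1 s2 g X Y|s1 s2 s3 X].
  by case: s1 s2 => [|? [|??]] [|??] //=; rewrite mulr0 addr0.
by case: s1 s2 => [|? [|??]] [|??].
Qed.

Lemma is_kform2 W : (forall f x y z, W (f *: x + y) z = f * W x z + W y z) ->
  (forall f x y z, W z (f *: x + y) = f * W z x + W z y) ->
  (forall x, W x x = 0) -> is_kform 2 (kform2 W).
Proof.
move=> Wl Wr Wa; split=> [[|? [|? []]]//|s1 s2 g X Y|s1 s2 s3 X].
  by case: s1 s2 => [|? [|? [|??]]] [|? [|??]] //=; rewrite mulr0 addr0.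
by case: s1 s2 s3 => [|? [|? [|??]]] [|? [|??]] [|??] /=.
Qed.

Section TwoForm.
Variables (P : kform B) (kP : is_kform 2 P).

Lemma kform2_linl f x y z : P [:: f *: x + y; z] = f * P [:: x; z] + P [:: y; z].
Proof. by case: kP => _ h _; exact: (h [::] [:: z]). Qed.

Lemma kform2_linr f x y z : P [:: z; f *: x + y] = f * P [:: z; x] + P [:: z; y].
Proof. by case: kP => _ h _; exact: (h [:: z] [::]). Qed.

Lemma kform2_alt x : P [:: x; x] = 0.
Proof. by case: kP => _ _ h; exact: (h [::] [::] [::]). Qed.

Lemma kform2_skew x y : P [:: x; y] = - P [:: y; x].
Proof.
have := kform2_alt (1 *: x + y).
rewrite kform2_linl !kform2_linr !kform2_alt !mul1r add0r addr0 => /eqP.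
by rewrite addr_eq0 => /eqP.
Qed.

Lemma kform2E : P = kform2 (fun x y => P [:: x; y]).
Proof. by case: kP => P0 _ _; apply: kformP => -[|? [|? [|??]]];
  do ?[by []|by rewrite P0]. Qed.

End TwoForm.

(** Splitting off the first bit reduces a sum over shuffles of a sequence of
    known length to an explicit sum, which is how wedge products are evaluated
    below. *)
Lemma big_bitseqS (F : bitseq -> Cinfty M) k :
  \sum_(m : k.+1.-tuple bool) F m =
  \sum_(m : k.-tuple bool) F (true :: m) + \sum_(m : k.-tuple bool) F (false :: m).
Proof.
rewrite (reindex (fun bm : bool * k.-tuple bool => [tuple of bm.1 :: bm.2])) /=.
  rewrite -(pair_big predT predT (fun b (m : k.-tuple bool) => F (b :: m))) /=.
  by rewrite big_bool.
exists (fun m => (thead m, [tuple of behead m])) => [[b m] _|m _] /=.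
  by rewrite theadE; congr pair; apply: val_inj.
by rewrite [RHS]tuple_eta.
Qed.

Lemma big_bitseq0 (F : bitseq -> Cinfty M) : \sum_(m : 0.-tuple bool) F m = F [::].
Proof.
rewrite (big_pred1 [tuple]) => [//|m]; first by rewrite (tuple0 m); apply/esym/eqP.
Qed.

Fixpoint mask_sum (k : nat) (F : bitseq -> Cinfty M) : Cinfty M :=
  if k is k'.+1 then
    mask_sum k' (fun m => F (true :: m)) + mask_sum k' (fun m => F (false :: m))
  else F [::].

Lemma kwedgeE v w s : kwedge v w s = mask_sum (size s) (fun m =>
  (-1) ^+ mask_inversions m * (v (mask m s) * w (mask (map negb m) s))).
Proof.
suff bigE k (F : bitseq -> Cinfty M) :
    \sum_(m : k.-tuple bool) F m = mask_sum k F.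
  exact: (bigE (size s) (fun m => (-1) ^+ mask_inversions m * (v (mask m s) * w
    (mask (map negb m) s)))).
elim: k F => [|k IH] F; first exact: big_bitseq0.
by rewrite big_bitseqS (IH (fun m => F (true :: m))) (IH (fun m => F (false :: m))).
Qed.

Lemma kwedge_fun f w : kwedge (kform_of_fun B f) w = kform_scale f w.
Proof.
apply: kformP => s; rewrite /kwedge /kform_scale.
rewrite (bigD1 [tuple of nseq (size s) false]) //= big1 => [|m mF].
  rewrite mask_false map_nseq mask_true//.
  have -> : mask_inversions (nseq (size s) false) = 0%N.
    by elim: (size s) => //= k ->; rewrite count_nseq muln0.
  by rewrite expr0 mul1r addr0.
rewrite (_ : kform_of_fun B f _ = 0) ?mul0r ?mulr0//.
suff : size (mask m s) != 0%N by case: (mask m s).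
rewrite size_mask ?size_tuple// -lt0n -has_count.
apply: contraR mF => h; apply/eqP/val_inj => /=; rewrite -{2}(size_tuple m).
apply/all_pred1P; move: h; rewrite -all_predC; apply: sub_all => b /=.
by case: b.
Qed.

Lemma kwedge0l w : kwedge 0 w = 0.
Proof. by apply: kformP => s; apply: big1 => m _; rewrite mul0r mulr0. Qed.

Lemma kwedge_1fun v f x :
  kwedge v (kform_of_fun B f) [:: x] = v [:: x] * f.
Proof. by rewrite kwedgeE /=; ring. Qed.

Lemma kwedge_11 V W :
  kwedge (kform1 V) (kform1 W) = kform2 (fun x y => V x * W y - V y * W x).
Proof.
apply: kformP => -[|x [|y [|z s]]].
- by rewrite kwedgeE /=; ring.
- by rewrite kwedgeE /=; ring.
- by rewrite kwedgeE /=; ring.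
rewrite /kwedge; apply: big1 => -[m /= /eqP sm] _.
suff: size (mask m [:: x, y, z & s]) != 1%N \/
  size (mask (map negb m) [:: x, y, z & s]) != 1%N.
  case: (mask m _) => [|? [|??]]; case: (mask (map _ m) _) => [|? [|??]];
  rewrite /= ?mul0r ?mulr0//; by case.
rewrite !size_mask ?size_map ?sm// count_map.
have := count_predC id m; rewrite sm.
case: (count id m) => [|[|k]] cm; [by left|right|by left].
by rewrite -[count (preim _ _) m]/(count (predC id) m); move: cm;
  rewrite add1n => -[->].
Qed.

Lemma kwedge_1 V w x y z : w [:: x; y; z] = 0 -> w [::] = 0 ->
  kwedge (kform1 V) w [:: x; y; z] =
    V x * w [:: y; z] - V y * w [:: x; z] + V z * w [:: x; y].
Proof. by move=> w3 w0; rewrite kwedgeE /= ?w3 ?w0; ring. Qed.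

Lemma kwedge_l1 v W x y z :
  kwedge v (kform1 W) [:: x; y; z] =
    v [:: x; y] * W z - v [:: x; z] * W y + v [:: y; z] * W x.
Proof. by rewrite kwedgeE /=; ring. Qed.

Lemma kwedge_l2 v P x y z : is_kform 2 P ->
  kwedge v P [:: x; y; z] =
    v [:: x] * P [:: y; z] - v [:: y] * P [:: x; z] + v [:: z] * P [:: x; y].
Proof.
by move=> /kform2E ->; rewrite kwedgeE /=; ring.
Qed.

Lemma is_kform_kwedge_11 V W : (forall f x y, V (f *: x + y) = f * V x + V y) ->
  (forall f x y, W (f *: x + y) = f * W x + W y) ->
  is_kform 2 (kwedge (kform1 V) (kform1 W)).
Proof.
move=> Vl Wl; rewrite kwedge_11; apply: is_kform2 => [f x y z|f x y z|x];
rewrite ?Vl ?Wl; ring.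
Qed.

Section LinearOnTwoForms.
Variable Psi : kform B -> Cinfty M.
Hypothesis Psi_lin : forall f v w, is_kform 2 v -> is_kform 2 w ->
  Psi (kform_scale f v + w) = f * Psi v + Psi w.

Lemma form_linear0 : Psi 0 = 0.
Proof.
apply: addr_idem0; have := Psi_lin 1 (is_kform0 2) (is_kform0 2).
by rewrite kform_scale1 addr0 mul1r.
Qed.

Lemma form_linearZ f v : is_kform 2 v -> Psi (kform_scale f v) = f * Psi v.
Proof.
move=> kv; rewrite -[kform_scale f v]addr0 (Psi_lin _ kv (is_kform0 2)).
by rewrite form_linear0 addr0.
Qed.

Lemma is_kform_sum (I : Type) (s : seq I) k (f : I -> Cinfty M) (v : I -> kform B) :
  (forall i, is_kform k (v i)) -> is_kform k (\sum_(i <- s) kform_scale (f i) (v i)).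
Proof.
move=> kv; elim/big_rec: _ => [|i w _ kw]; first exact: is_kform0.
exact: is_kform_scaleD.
Qed.

Lemma form_linear_sum (I : Type) (s : seq I) (f : I -> Cinfty M) (v : I -> kform B) :
  (forall i, is_kform 2 (v i)) -> (forall i, Psi (v i) = 0) ->
  Psi (\sum_(i <- s) kform_scale (f i) (v i)) = 0.
Proof.
move=> kv Pv; elim: s => [|i s IH]; first by rewrite big_nil form_linear0.
by rewrite big_cons Psi_lin ?IH ?Pv ?mulr0 ?addr0//; exact: is_kform_sum.
Qed.

End LinearOnTwoForms.

End FormAlgebra.

(** * Two-sections are spanned by products of sections *)

Section Spanning.
Variables (R : realType) (n : nat) (M : manifold R n) (r : nat).
Variable A : vbundle M r.
Implicit Types (X Y : section A) (x y z : section (dual_bundle A)).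
Implicit Types (P Q : kform (dual_bundle A)) (f g : Cinfty M).

Lemma csm_half f : csm M 2^-1 * (f + f) = f.
Proof.
apply: cfun_inj => p.
rewrite cfunME -[(f + f) p]/(f p + f p) /=.
by field.
Qed.

Lemma pairing_vec_lin X f x y :
  pairing (f *: x + y) X = f * pairing x X + pairing y X.
Proof. by rewrite pairingDl pairingZl. Qed.

Lemma is_kform_vec X : is_kform 1 (kform_of_vec X).
Proof. by apply: is_kform1 => f x y; exact: pairing_vec_lin. Qed.

Lemma is_kform_wedge X Y : is_kform 2 (kwedge (kform_of_vec X) (kform_of_vec Y)).
Proof. by apply: is_kform_kwedge_11 => f x y; exact: pairing_vec_lin. Qed.

Lemma wedgeE X Y x y : kwedge (kform_of_vec X) (kform_of_vec Y) [:: x; y] =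
  pairing x X * pairing y Y - pairing y X * pairing x Y.
Proof. by rewrite kwedge_11. Qed.

(** With h the square of the bump function chi of [local_frame],
    h P(x, y) = P(chi x, chi y) expands by bilinearity into the products
    <x, X_i> <y, X_j>; averaging with the exchanged indices turns these into
    the values of X_i ^ X_j, whence the factor 1/2 in the coefficients. *)
Lemma two_section_decomp P p : is_kform 2 P ->
  exists (X : 'I_r -> section A) (c : 'I_r * 'I_r -> Cinfty M) (h : Cinfty M),
  h p = 1 /\ kform_scale h P = \sum_ij kform_scale (c ij)
      (kwedge (kform_of_vec (X ij.1)) (kform_of_vec (X ij.2))).
Proof.
move=> kP; have [X [xi [chi [chi1 _ Hchi]]]] := local_frame A p.
pose b i j := chi * chi * P [:: xi i; xi j].
exists X, (fun ij => csm M 2^-1 * b ij.1 ij.2), (chi * chi); split.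
  by rewrite cfunME (nbhs_singleton chi1) mulr1.
have lhs x y : chi * chi * P [:: x; y]
    = \sum_i \sum_j b i j * (pairing x (X i) * pairing y (X j)).
  have Pl f u v w := kform2_linl kP f u v w.
  have Pr f u v w := kform2_linr kP f u v w.
  rewrite -mulrA -(sec_linearZ (W := fun v => P [:: x; v])) // -(sec_linearZ
    (W := fun u => P [:: u; _])) //.
  rewrite !Hchi (sec_linear_sum (W := fun u => P [:: u; _])) //; apply: eq_bigr => i _.
  rewrite (sec_linearZ (W := fun u => P [:: u; _])) // (sec_linear_sum
    (W := fun v => P [:: _; v])) // mulr_sumr.
  by apply: eq_bigr => j _; rewrite (sec_linearZ (W := fun v => P [:: _;
    v])) // /b; ring.
have bC i j : b i j = - b j i by rewrite /b (kform2_skew kP); ring.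
have kS : is_kform 2 (\sum_ij kform_scale (csm M 2^-1 * b ij.1 ij.2)
      (kwedge (kform_of_vec (X ij.1)) (kform_of_vec (X ij.2)))).
  by apply: is_kform_sum => ij; exact: is_kform_wedge.
rewrite (kform2E (is_kform_scale (chi * chi) kP)) (kform2E kS).
apply: kformP => -[|x [|y [|z s]]] //=; rewrite /kform_scale lhs fct_sumE.
rewrite -[LHS]csm_half {2}exchange_big /= -big_split /= mulr_sumr.
under [in RHS]eq_bigr do rewrite wedgeE.
rewrite -(pair_bigA _ (fun i j => csm M 2^-1 * b i j *
  (pairing x (X i) * pairing y (X j) - pairing y (X i) * pairing x (X j)))) /=.
apply: eq_bigr => i _.
rewrite -big_split /= mulr_sumr; apply: eq_bigr => j _.
by rewrite (bC j i); ring.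
Qed.

(** At each point p, Psi(P)(p) = (h Psi(P))(p) = Psi(h P)(p) = 0, where h is the
    function of [two_section_decomp]. *)
Lemma two_section_ind (Psi : kform (dual_bundle A) -> Cinfty M) :
  (forall f P Q, is_kform 2 P -> is_kform 2 Q ->
    Psi (kform_scale f P + Q) = f * Psi P + Psi Q) ->
  (forall X Y, Psi (kwedge (kform_of_vec X) (kform_of_vec Y)) = 0) ->
  forall P, is_kform 2 P -> Psi P = 0.
Proof.
move=> Plin Pw P kP; apply: cfun_inj => p.
have [X [c [h [hp hP]]]] := two_section_decomp p kP.
have := form_linearZ Plin h kP.
rewrite hP (form_linear_sum Plin) => [|ij|ij]; [|exact: is_kform_wedge|exact: Pw].
by move=> /(congr1 (fun f : Cinfty M => f p)); rewrite cfunME hp mul1r.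
Qed.

(** P^sharp on sections, for 2-sections P that need not come from a given bundle
    map; it exists by [represent_vec]. *)
Definition sharp P x : section A :=
  vec_of_kform (kform1 (fun y => P [:: x; y])).

Lemma vec_of_kform1 (W : section (dual_bundle A) -> Cinfty M) :
  (forall f x y, W (f *: x + y) = f * W x + W y) ->
  forall x, pairing x (vec_of_kform (kform1 W)) = W x.
Proof.
move=> /represent_vec[X XW] x; rewrite /vec_of_kform.
have : [set X | kform_of_vec X = kform1 W] (xget 0 [set X | kform_of_vec X = kform1 W]).
  apply: (@xgetPex _ 0); exists X => /=; apply: kformP => -[|y []] //=; exact: XW.
by move=> /= /(congr1 (fun w => w [:: x])).
Qed.

Lemma sharpE P x y : is_kform 2 P -> pairing y (sharp P x) = P [:: x; y].
Proof.
move=> kP; rewrite /sharp (vec_of_kform1 (W := fun y => P [:: x; y])) // => f u v.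
exact: kform2_linr.
Qed.

Lemma sharp_lin f P Q x : is_kform 2 P -> is_kform 2 Q ->
  sharp (kform_scale f P + Q) x = f *: sharp P x + sharp Q x.
Proof.
move=> kP kQ; apply: pairing_injr => y; rewrite pairingDr pairingZr !sharpE//.
exact: is_kform_scaleD.
Qed.

Lemma sharp_wedge X Y x : sharp (kwedge (kform_of_vec X) (kform_of_vec Y)) x
  = pairing x X *: Y - pairing x Y *: X.
Proof.
apply: pairing_injr => y; rewrite sharpE ?wedgeE; last exact: is_kform_wedge.
rewrite -scaleN1r pairingDr !pairingZr; ring.
Qed.

End Spanning.

(** * Removing the twist *)

Section Untwist.
Variables (R : realType) (n : nat) (M : manifold R n) (phi : diffeo M) (r : nat).
Implicit Types f g : Cinfty M.

(** With the inverse diffeomorphism as a [diffeo], the inverse of the pull-back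
    is itself a pull-back and inherits all its algebraic rules. *)
Definition inv_diffeo : diffeo M :=
  Diffeo (dmap_invK phi) (dmapK phi) (dmap_inv_smooth phi) (dmap_smooth phi).

Definition ipull f : Cinfty M := pull inv_diffeo f.

Lemma pullK f : ipull (pull phi f) = f.
Proof. by apply: cfun_inj => p /=; rewrite dmap_invK. Qed.

Lemma ipullK f : pull phi (ipull f) = f.
Proof. by apply: cfun_inj => p /=; rewrite dmapK. Qed.

Lemma pullD (psi : diffeo M) f g : pull psi (f + g) = pull psi f + pull psi g.
Proof. exact: cfun_inj. Qed.

Lemma pullM (psi : diffeo M) f g : pull psi (f * g) = pull psi f * pull psi g.
Proof. exact: cfun_inj. Qed.

Lemma pull0 (psi : diffeo M) : pull psi 0 = 0.
Proof. exact: cfun_inj. Qed.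

Lemma pull1 (psi : diffeo M) : pull psi 1 = 1.
Proof. exact: cfun_inj. Qed.

Lemma pullN (psi : diffeo M) f : pull psi (- f) = - pull psi f.
Proof. exact: cfun_inj. Qed.

Lemma pullX (psi : diffeo M) f k : pull psi (f ^+ k) = pull psi f ^+ k.
Proof. by elim: k => [|k IH]; rewrite ?expr0 ?pull1// !exprS pullM IH. Qed.

Lemma pull_csm (psi : diffeo M) a : pull psi (csm M a) = csm M a.
Proof. exact: cfun_inj. Qed.

Variables (A : vbundle M r) (L : hom_lie_algebroid phi A).
Implicit Types X Y Z : section A.

(** The untwisted bracket and anchor.  In the Leibniz rule of the Hom-bracket
    every coefficient is pulled back and every section twisted; applying the
    inverse twist leaves the rule of an ordinary Lie algebroid, [ubrZr]. *)
Definition ubr X Y : section A := twist_inv L (lbr L X Y).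

Definition uact X f : Cinfty M := ipull (anchor_act (anch L) (twist L X) f).

Lemma twist_scaleD f X Y : twist L (f *: X + Y) = pull phi f *: twist L X + twist L Y.
Proof. by rewrite twistD twistZ. Qed.

Lemma twist_inv_scaleD f X Y :
  twist_inv L (f *: X + Y) = ipull f *: twist_inv L X + twist_inv L Y.
Proof.
by apply: (can_inj (twistK L)); rewrite twist_scaleD ipullK !twist_invK.
Qed.

Lemma lbrDr X Y Z : lbr L X (Y + Z) = lbr L X Y + lbr L X Z.
Proof. by have := lbr_linear L 1 X Y Z; rewrite !csm1 !scale1r. Qed.

Lemma twist_invD X Y : twist_inv L (X + Y) = twist_inv L X + twist_inv L Y.
Proof. by have := twist_inv_scaleD 1 X Y; rewrite scale1r [ipull 1]pull1 scale1r. Qed.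

Lemma twist_inv0 : twist_inv L 0 = 0.
Proof. by apply: addr_idem0; rewrite -twist_invD addr0. Qed.

Lemma twist_invN X : twist_inv L (- X) = - twist_inv L X.
Proof.
by apply/eqP; rewrite -addr_eq0 -twist_invD addNr twist_inv0.
Qed.

Lemma ubrDr X Y Z : ubr X (Y + Z) = ubr X Y + ubr X Z.
Proof. by rewrite /ubr lbrDr twist_invD. Qed.

Lemma ubr_skew X Y : ubr X Y = - ubr Y X.
Proof. by rewrite /ubr lbr_skew twist_invN. Qed.

Lemma ubrZr X f Y : ubr X (f *: Y) = f *: ubr X Y + uact X f *: Y.
Proof.
rewrite /ubr lbr_leibniz twist_inv_scaleD pullK; congr (_ + _).
by rewrite -[_ *: twist L Y]addr0 twist_inv_scaleD twist_inv0 twistK addr0.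
Qed.

Lemma anchor_act_scaleD f X Y g : anchor_act (anch L) (f *: X + Y) g
  = f * anchor_act (anch L) X g + anchor_act (anch L) Y g.
Proof. by apply: cfun_inj => p; exact: anchor_linear. Qed.

Lemma uact_scaleD f X Y g : uact (f *: X + Y) g = f * uact X g + uact Y g.
Proof.
by rewrite /uact twist_scaleD anchor_act_scaleD [ipull _]pullD [pull _ (_ * _)]pullM
  -![pull inv_diffeo _]/(ipull _) pullK.
Qed.

Lemma uact0l g : uact 0 g = 0.
Proof. by apply: addr_idem0; have := uact_scaleD 1 0 0 g;
  rewrite scaler0 addr0 mul1r. Qed.

Lemma uactZl f X g : uact (f *: X) g = f * uact X g.
Proof. by rewrite -[f *: X]addr0 uact_scaleD uact0l addr0. Qed.

Lemma anchor_actD X f g : anchor_act (anch L) X (f + g)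
  = anchor_act (anch L) X f + anchor_act (anch L) X g.
Proof.
apply: cfun_inj => p; have := tdir_linear (anch L p (X p)) 1 f g.
by rewrite csm1 !mul1r.
Qed.

Lemma uactD X f g : uact X (f + g) = uact X f + uact X g.
Proof. by rewrite /uact anchor_actD [ipull _]pullD. Qed.

Lemma anchor_act0 X : anchor_act (anch L) X 0 = 0.
Proof.
by apply: addr_idem0; rewrite -anchor_actD addr0.
Qed.

Lemma uact0 X : uact X 0 = 0.
Proof. by rewrite /uact anchor_act0 [ipull _]pull0. Qed.

Lemma uactN X f : uact X (- f) = - uact X f.
Proof. by apply/eqP; rewrite -addr_eq0 -uactD addNr uact0. Qed.

Lemma anchor_actM X f g : anchor_act (anch L) X (f * g)
  = pull phi f * anchor_act (anch L) X g + pull phi g * anchor_act (anch L) X f.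
Proof. by apply: cfun_inj => p; exact: tdir_leibniz. Qed.

Lemma uactM X f g : uact X (f * g) = f * uact X g + g * uact X f.
Proof.
by rewrite /uact anchor_actM [ipull _]pullD [in LHS]pullM
  -[pull inv_diffeo (pull phi f)]/(ipull _) pullK [X in _ + X]pullM
  -[pull inv_diffeo (pull phi g)]/(ipull _) pullK.
Qed.

Lemma anchor_actE X f : anchor_act (anch L) X f = uact X (pull phi f).
Proof. by rewrite /uact anch_twist pullK. Qed.

Lemma uact_twist X f : uact (twist L X) (pull phi f) = pull phi (uact X f).
Proof. by rewrite -anchor_actE /uact ipullK. Qed.

Lemma twist_ubr X Y : twist L (ubr X Y) = lbr L X Y.
Proof. exact: twist_invK. Qed.

Lemma ubr_twist X Y : ubr (twist L X) (twist L Y) = twist L (ubr X Y).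
Proof. by rewrite /ubr -twist_lbr twistK twist_invK. Qed.

Lemma lbr_twist_inv X Y : lbr L (twist_inv L X) (twist_inv L Y) = ubr X Y.
Proof. by rewrite -[in RHS](twist_invK L X) -[in RHS](twist_invK L Y) ubr_twist
  twist_ubr. Qed.

(** The differential is the untwisted one applied to the dagger of the form:
    the inverse twist on the arguments of w is absorbed in [dagger], together
    with the pull-back in [anchor_act X f = uact X (pull phi f)]. *)
Lemma algd_diff_1E (w : kform A) X Y : algd_diff L w [:: X; Y] =
  uact X (dagger L w [:: Y]) - uact Y (dagger L w [:: X]) - dagger L w [:: ubr X Y].
Proof.
rewrite /algd_diff /= !big_ord_recl !big_ord0 /= !lbr_twist_inv !anchor_actE /bump /=.
rewrite /rem_at /= /dagger /= expr0 !expr1; ring.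
Qed.

Lemma algd_diff_2E (w : kform A) X Y Z : algd_diff L w [:: X; Y; Z] =
  uact X (dagger L w [:: Y; Z]) - uact Y (dagger L w [:: X; Z])
  + uact Z (dagger L w [:: X; Y])
  - dagger L w [:: ubr X Y; Z] + dagger L w [:: ubr X Z; Y]
  - dagger L w [:: ubr Y Z; X].
Proof.
rewrite /algd_diff /= !big_ord_recl !big_ord0 /= !lbr_twist_inv !anchor_actE /bump /=.
rewrite /rem_at /= /dagger /=; ring.
Qed.

Lemma algd_diff_degree k (w : kform A) s :
  (forall s, size s != k -> w s = 0) -> size s != k.+1 -> algd_diff L w s = 0.
Proof.
move=> w0 sk.
have size_rem (T : Type) i (t : seq T) : (i < size t)%N -> size (rem_at i t) =
  (size t).-1.
  by move=> it; rewrite /rem_at size_cat size_take it size_drop; lia.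
rewrite /algd_diff !big1 ?addr0// => [j _|i _].
  rewrite big1// => i _; rewrite /dagger w0 ?pull0 ?mulr0//= size_map.
  by rewrite !size_rem ?size_rem//; have := ltn_ord i; have := ltn_ord j; move: sk; lia.
rewrite w0 ?anchor_act0 ?mulr0// size_map size_rem ?ltn_ord//.
by have := ltn_ord i; move: sk; lia.
Qed.

End Untwist.

(** * An explicit formula for the Schouten bracket *)

Section UntwistedSchouten.
Variables (R : realType) (n : nat) (M : manifold R n) (phi : diffeo M) (r : nat).
Variables (A : vbundle M r) (P : hom_lie_pair phi A).
Variable S : kform (dual_bundle A) -> kform (dual_bundle A) -> kform (dual_bundle A).
Hypothesis hS : is_hom_schouten P S.
Implicit Types (X Y : section A) (x y z : section (dual_bundle A)).
Implicit Types (v w D : kform (dual_bundle A)) (f g : Cinfty M).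

Local Notation tw := (twist (LAd P)).
Local Notation br := (ubr (LA P)).
Local Notation act := (uact (LA P)).

Lemma pairing_twist x X :
  pairing (tw x) (twist (LA P) X) = pull phi (pairing x X).
Proof. by rewrite twist_dagger twistK. Qed.

Definition undagger w : kform (dual_bundle A) := fun s => ipull phi (w (map tw s)).

Lemma daggerK w : undagger (twist_multi P w) = w.
Proof.
apply: kformP => s; rewrite /undagger /twist_multi /dagger pullK -map_comp.
by rewrite (eq_map (g := id)) ?map_id// => x /=; rewrite twistK.
Qed.

Lemma undaggerD v w : undagger (v + w) = undagger v + undagger w.
Proof. by apply: kformP => s; rewrite /undagger [ipull _ _]pullD. Qed.

Lemma undaggerN w : undagger (- w) = - undagger w.
Proof. by apply: kformP => s; rewrite /undagger [ipull _ _]pullN. Qed.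

Lemma undaggerZ f w : undagger (kform_scale f w) = kform_scale (ipull phi f)
  (undagger w).
Proof. by apply: kformP => s; rewrite /undagger [ipull _ _]pullM. Qed.

Lemma pull_sign (psi : diffeo M) k : pull psi ((-1) ^+ k) = (-1) ^+ k.
Proof. by rewrite pullX pullN pull1. Qed.

Lemma undagger_kwedge v w : undagger (kwedge v w) = kwedge (undagger v) (undagger w).
Proof.
apply: kformP => s; rewrite /undagger !kwedgeE size_map.
have ipull_sum k (F : bitseq -> Cinfty M) :
    ipull phi (mask_sum k F) = mask_sum k (fun m => ipull phi (F m)).
  by elim: k F => //= k IH F; rewrite [ipull _ _]pullD -!IH.
rewrite ipull_sum; congr mask_sum; apply/funext => m.
by rewrite [ipull _ _]pullM [X in _ * X]pullM [X in X * _]pull_sign !map_mask.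
Qed.

Lemma is_kform_undagger k w : is_kform k w -> is_kform k (undagger w).
Proof.
move=> [w0 wl wa]; split=> [s sk|s1 s2 f x y|s1 s2 s3 x]; rewrite /undagger.
- by rewrite w0 ?size_map// [ipull _ _]pull0.
- rewrite !map_cat /= twist_scaleD wl [ipull _ _]pullD [X in X + _]pullM.
  by rewrite -[pull _ (pull phi f)]/(ipull phi _) pullK.
- by rewrite map_cat /= map_cat wa [ipull _ _]pull0.
Qed.

(** The untwisted Schouten bracket.  Since [undagger] is multiplicative, its
    Leibniz rule [uS_wedge] is the ordinary graded one. *)
Definition uS v w := undagger (S v w).

Lemma uS_form k l v w : is_kform k v -> is_kform l w -> is_kform (k + l).-1 (uS v w).
Proof. by move=> kv lw; apply: is_kform_undagger;
  exact: schouten_form hS _ _ _ _ kv lw. Qed.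

Lemma uSDr k l D v w : is_kform k D -> is_kform l v -> is_kform l w ->
  uS D (v + w) = uS D v + uS D w.
Proof.
move=> kD lv lw; rewrite /uS -undaggerD.
by have := schouten_linearr hS 1 kD lv lw; rewrite csm1 !kform_scale1 => ->.
Qed.

Lemma uS_skew k l v w : is_kform k v -> is_kform l w ->
  uS v w = - kform_scale ((-1) ^+ (k.+1 * l.+1)) (uS w v).
Proof.
move=> kv lw; rewrite {1}/uS (schouten_skew hS kv lw) undaggerN undaggerZ.
by rewrite [ipull _ _]pull_sign.
Qed.

Lemma uS_wedge k l m D v w : is_kform k D -> is_kform l v -> is_kform m w ->
  uS D (kwedge v w) =
    kwedge (uS D v) w + kform_scale ((-1) ^+ (k.+1 * l)) (kwedge v (uS D w)).
Proof.
move=> kD lv mw; rewrite {1}/uS (schouten_wedge hS kD lv mw) undaggerD undaggerZ.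
by rewrite !undagger_kwedge !daggerK [ipull _ _]pull_sign.
Qed.

Lemma uS_vec X Y : uS (kform_of_vec X) (kform_of_vec Y) = kform_of_vec (br X Y).
Proof.
rewrite /uS (schouten_vec hS); apply: kformP => -[|x [|y s]] /=;
  rewrite /undagger /= ?[ipull _ _]pull0// twist_dagger.
exact: pullK.
Qed.

Lemma uS_fun f g :
  uS (kform_of_fun (dual_bundle A) f) (kform_of_fun (dual_bundle A) g) = 0.
Proof.
by rewrite /uS (schouten_fun hS); apply: kformP => s;
  rewrite /undagger [ipull _ _]pull0.
Qed.

Lemma uS_vec_fun X f : uS (kform_of_vec X) (kform_of_fun (dual_bundle A) f)
  = kform_of_fun (dual_bundle A) (act X f).
Proof.
rewrite /uS (schouten_vec_fun hS); apply: kformP => -[|x s] //.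
by rewrite /undagger /= [ipull _ _]pull0.
Qed.

(** Multiplication by a function is a wedge product with a 0-form, so the graded
    Leibniz rule says how far [uS D] is from being linear over functions.  The
    proofs by [two_section_ind] below check that the explicit right-hand sides
    have the same defect. *)
Lemma uS_scaleDr k l D f v w : is_kform k D -> is_kform l v -> is_kform l w ->
  uS D (kform_scale f v + w) =
    kwedge (uS D (kform_of_fun (dual_bundle A) f)) v + kform_scale f (uS D v) + uS D w.
Proof.
move=> kD lv lw; rewrite (uSDr kD _ lw); last exact: is_kform_scale.
rewrite -kwedge_fun (uS_wedge kD (is_kform_fun _ f) lv) muln0 expr0 kform_scale1.
by rewrite !kwedge_fun.
Qed.

Local Notation vec := (@kform_of_vec R n M r A).
Local Notation fn := (@kform_of_fun R n M r (dual_bundle A)).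

Lemma uS_fun_vec f X : uS (fn f) (vec X) = fn (- act X f).
Proof.
rewrite (uS_skew (is_kform_fun _ f) (is_kform_vec X)) uS_vec_fun.
apply: kformP => -[|x s]; rewrite kformNE /kform_scale /= ?mulr0 ?oppr0//.
by rewrite -signr_odd /=; ring.
Qed.

Lemma uS_fun_twosection f v x : is_kform 2 v -> uS (fn f) v [:: x] = act (sharp v x) f.
Proof.
move=> kv; apply/eqP; rewrite -subr_eq0; apply/eqP; move: v kv.
apply: two_section_ind => [g v w kv kw|X Y].
  rewrite (uS_scaleDr g (is_kform_fun _ f) kv kw) uS_fun kwedge0l add0r sharp_lin//.
  by rewrite uact_scaleD kformDE /kform_scale; ring.
rewrite (uS_wedge (is_kform_fun _ f) (is_kform_vec X) (is_kform_vec Y)).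
rewrite !uS_fun_vec kwedge_fun kformDE /kform_scale kwedge_1fun sharp_wedge /=.
by rewrite -scaleNr uact_scaleD uactZl -signr_odd /=; ring.
Qed.

Lemma uS_twosection_fun v f x : is_kform 2 v -> uS v (fn f) [:: x] = act (sharp v x) f.
Proof.
move=> kv; rewrite (uS_skew kv (is_kform_fun _ f)) kformNE /kform_scale.
by rewrite uS_fun_twosection// -signr_odd /=; ring.
Qed.

(** The right-hand side is (L_X v)(x, y), written with brackets of vectors only:
    v(L_X x, y) = - <L_X x, v^sharp y> = <x, [X, v^sharp y]> - X <x, v^sharp y>
    avoids Lie derivatives of covectors. *)
Lemma uS_vec_twosection X v x y : is_kform 2 v -> uS (vec X) v [:: x; y] =
  pairing y (br X (sharp v x)) - pairing x (br X (sharp v y)) - act X (v [:: x; y]).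
Proof.
move=> kv; apply/eqP; rewrite -subr_eq0; apply/eqP; move: v kv.
apply: two_section_ind => [f v w kv kw|Y Z].
  rewrite (uS_scaleDr f (is_kform_vec X) kv kw) uS_vec_fun kwedge_fun !sharp_lin//.
  rewrite !ubrDr !ubrZr !pairingDr !pairingZr !kformDE /kform_scale uactD uactM
    !sharpE//.
  by rewrite (kform2_skew kv y x); ring.
rewrite (uS_wedge (is_kform_vec X) (is_kform_vec Y) (is_kform_vec Z)) !uS_vec.
rewrite kformDE /kform_scale !wedgeE !sharp_wedge -!scaleNr !ubrDr !ubrZr.
rewrite !pairingDr !pairingZr !(uactD, uactN, uactM) -signr_odd /=; ring.
Qed.

Lemma uS_twosection_vec X v x y : is_kform 2 v -> uS v (vec X) [:: x; y] =
  act X (v [:: x; y]) + pairing x (br X (sharp v y)) - pairing y (br X (sharp v x)).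
Proof.
move=> kv; rewrite (uS_skew kv (is_kform_vec X)) kformNE /kform_scale.
by rewrite uS_vec_twosection// -signr_odd /=; ring.
Qed.

(** One cyclic third of the polarisation of the classical formula
    1/2 [pi, pi](x, y, z) = cyc (<x, [pi^sharp y, pi^sharp z]>
    + pi^sharp x (pi(z, y))).  Polarising is what makes an induction on one
    argument possible while the other one is fixed. *)
Definition schouten_formula v w x y z : Cinfty M :=
  pairing x (br (sharp v y) (sharp w z)) + pairing x (br (sharp w y) (sharp v z))
  + act (sharp v x) (w [:: z; y]) + act (sharp w x) (v [:: z; y]).

Lemma uS_twosections v w x y z : is_kform 2 v -> is_kform 2 w ->
  uS v w [:: x; y; z] = schouten_formula v w x y z + schouten_formula v w y z x
    + schouten_formula v w z x y.
Proof.
move=> kv kw; apply/eqP; rewrite -subr_eq0; apply/eqP; move: w kw.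
rewrite /schouten_formula; apply: two_section_ind => [f w w' kw kw'|X Y].
  rewrite (uS_scaleDr f kv kw kw') !kformDE kwedge_l2// !uS_twosection_fun//
    !sharp_lin//.
  rewrite ![ubr _ (_ + _) (sharp v _)]ubr_skew !ubrDr !ubrZr -!scaleN1r.
  rewrite !pairingZr !pairingDr !pairingZr.
  rewrite ![ubr _ (sharp v _) (sharp w _)]ubr_skew ![ubr _ (sharp v _)
    (sharp w' _)]ubr_skew.
  rewrite -!scaleN1r !pairingZr !uact_scaleD /kform_scale !(uactD, uactM, uactN)
    !sharpE//.
  rewrite (kform2_skew kw z y) (kform2_skew kw x z) (kform2_skew kw y x) !uactN.
  ring.
rewrite (uS_wedge kv (is_kform_vec X) (is_kform_vec Y)) kformDE /kform_scale.
have [uS0 _ _] := uS_form kv (is_kform_vec Y).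
rewrite (kwedge_l1 _ (fun x => pairing x Y)) (kwedge_1 (fun x => pairing x X));
  [|exact: uS0|exact: uS0].
rewrite !uS_twosection_vec// !sharp_wedge !wedgeE.
rewrite -!scaleNr ![br (_ + _) (sharp v _)]ubr_skew !ubrDr !ubrZr.
rewrite ![br (sharp v _) _]ubr_skew -!scaleN1r.
rewrite !(pairingDr, pairingZr, uact_scaleD, uactZl, uactD, uactN, uactM).
rewrite (kform2_skew kv z y) (kform2_skew kv x z) (kform2_skew kv y x) !uactN.
rewrite -signr_odd /=; ring.
Qed.

End UntwistedSchouten.

(** * Lie derivatives and contractions as sections *)

Section CartanCalculus.
Variables (R : realType) (n : nat) (M : manifold R n) (phi : diffeo M) (r : nat).
Variables (A : vbundle M r) (L : hom_lie_algebroid phi A).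
Implicit Types (X Y Z : section A) (f g : Cinfty M).

Lemma pull_twist_lin (G : section A -> Cinfty M) :
  (forall f X Y, G (f *: X + Y) = f * G X + G Y) ->
  forall f X Y, pull phi (G (twist_inv L (f *: X + Y)))
    = f * pull phi (G (twist_inv L X)) + pull phi (G (twist_inv L Y)).
Proof. by move=> Gl f X Y; rewrite twist_inv_scaleD Gl pullD pullM ipullK. Qed.

Variable W : section A -> Cinfty M.
Hypothesis Wlin : forall f X Y, W (f *: X + Y) = f * W X + W Y.

(** The derivative of the coefficient produced by the anchor cancels against the
    one produced by the bracket, so the Lie derivative of a 1-form is a 1-form. *)
Lemma lie_lin X f Y Z :
  uact L X (W (f *: Y + Z)) - W (ubr L X (f *: Y + Z))
  = f * (uact L X (W Y) - W (ubr L X Y)) + (uact L X (W Z) - W (ubr L X Z)).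
Proof.
rewrite ubrDr ubrZr -[_ + ubr L X Z]addrA !Wlin uactD uactM; ring.
Qed.

Lemma contract_diff_lin X f Y Z :
  let G V := uact L X (W V) - uact L V (W X) - W (ubr L X V) in
  G (f *: Y + Z) = f * G Y + G Z.
Proof.
rewrite /= ubrDr ubrZr -[_ + ubr L X Z]addrA !Wlin uactD uactM uact_scaleD; ring.
Qed.

Lemma lie_derivativeE X : lie_derivative L X (kform1 W)
  = kform1 (fun Y => pull phi (uact L X (W (twist_inv L Y))
                               - W (ubr L X (twist_inv L Y)))).
Proof.
apply: kformP => -[|Y []] //=.
by rewrite /dagger /= pullD pullN {1}/uact ipullK.
Qed.

(** The twist of X in the contraction undoes the inverse twist of the arguments,
    so that contracting dw is the untwisted contraction followed by the
    pull-back. *)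
Lemma interior_diffE (w : kform A) X : (forall s, size s != 1%N -> w s = 0) ->
  (forall Y, dagger L w [:: Y] = W Y) ->
  interior_product L X (algd_diff L w)
  = kform1 (fun Y => pull phi (uact L X (W (twist_inv L Y))
      - uact L (twist_inv L Y) (W X) - W (ubr L X (twist_inv L Y)))).
Proof.
move=> w1 wW; apply: kformP => s; rewrite /interior_product /dagger /=.
have [/eqP|s1] := boolP (size s == 1%N); last first.
  rewrite (algd_diff_degree L w1) ?pull0 /=; first by case: s s1 => [|? []].
  by rewrite size_map eqSS.
by case: s => [|Y []] //= _; rewrite algd_diff_1E !wW twistK.
Qed.

End CartanCalculus.

Section DualCartan.
Variables (R : realType) (n : nat) (M : manifold R n) (phi : diffeo M) (r : nat).
Variables (A : vbundle M r) (P : hom_lie_pair phi A).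
Implicit Types (X Y Z : section A) (x y z : section (dual_bundle A)).

Lemma pairing_sec_lin x f X Y :
  pairing x (f *: X + Y) = f * pairing x X + pairing x Y.
Proof. by rewrite pairingDr pairingZr. Qed.

Lemma covec_of_kform1 (W : section A -> Cinfty M) :
  (forall f X Y, W (f *: X + Y) = f * W X + W Y) ->
  forall X, pairing (covec_of_kform (kform1 W)) X = W X.
Proof.
move=> /represent_covec[x xW] X; rewrite /covec_of_kform.
have : [set x | kform_of_covec x = kform1 W]
  (xget 0 [set x | kform_of_covec x = kform1 W]).
  apply: (@xgetPex _ 0); exists x => /=; apply: kformP => -[|Y []] //=; exact: xW.
by move=> /= /(congr1 (fun w => w [:: X])).
Qed.

(** Pairing with a twisted argument exhibits the section as the twist of an
    untwisted Lie derivative or, in the last two of these four lemmas, of an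
    untwisted contraction. *)
Lemma pairing_lie_vec x Y z :
  pairing (twist (LAd P) z) (vec_of_kform (lie_derivative (LAd P) x (kform_of_vec Y)))
  = pull phi (uact (LAd P) x (pairing z Y) - pairing (ubr (LAd P) x z) Y).
Proof.
pose W z := pairing z Y; have Wl f u v : W (f *: u + v) = f * W u + W v.
  exact: pairing_vec_lin.
rewrite (lie_derivativeE _ W) vec_of_kform1 ?twistK// => f u v.
exact: (pull_twist_lin _ (lie_lin _ Wl x)).
Qed.

Lemma pairing_lie_covec X y Z :
  pairing (covec_of_kform (lie_derivative (LA P) X (kform_of_covec y))) (twist (LA P) Z)
  = pull phi (uact (LA P) X (pairing y Z) - pairing y (ubr (LA P) X Z)).
Proof.
pose W Z := pairing y Z; have Wl f u v : W (f *: u + v) = f * W u + W v.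
  exact: pairing_sec_lin.
rewrite (lie_derivativeE _ W) covec_of_kform1 ?twistK// => f u v.
exact: (pull_twist_lin _ (lie_lin _ Wl X)).
Qed.

Lemma pairing_interior_vec X y z :
  pairing (twist (LAd P) z) (vec_of_kform (interior_product (LAd P) y
    (algd_diff (LAd P) (kform_of_vec (twist_inv (LA P) X)))))
  = pull phi (uact (LAd P) y (pairing z X) - uact (LAd P) z (pairing y X)
              - pairing (ubr (LAd P) y z) X).
Proof.
pose W z := pairing z X; have Wl f u v : W (f *: u + v) = f * W u + W v.
  exact: pairing_vec_lin.
rewrite (interior_diffE (W := W)) => [|[|? []]//|x].
  rewrite vec_of_kform1 ?twistK// => f u v.
  exact: (pull_twist_lin _ (contract_diff_lin _ Wl y)).
by rewrite /dagger /= -twist_dagger twist_invK.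
Qed.

Lemma pairing_interior_covec x Y Z :
  pairing (covec_of_kform (interior_product (LA P) Y
    (algd_diff (LA P) (kform_of_covec (twist_inv (LAd P) x))))) (twist (LA P) Z)
  = pull phi (uact (LA P) Y (pairing x Z) - uact (LA P) Z (pairing x Y)
              - pairing x (ubr (LA P) Y Z)).
Proof.
pose W Z := pairing x Z; have Wl f u v : W (f *: u + v) = f * W u + W v.
  exact: pairing_sec_lin.
rewrite (interior_diffE (W := W)) => [|[|? []]//|X].
  rewrite covec_of_kform1 ?twistK// => f u v.
  exact: (pull_twist_lin _ (contract_diff_lin _ Wl Y)).
by rewrite /dagger /= -twist_dagger twist_invK.
Qed.

End DualCartan.

(** * The graph of a bundle map *)

Section Graph.
Variables (R : realType) (n : nat) (M : manifold R n) (phi : diffeo M) (r : nat).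
Variables (A : vbundle M r) (H : bmap (dual_bundle A) A).
Implicit Types (x y z : section (dual_bundle A)).

Lemma graph_map_linear p :
  linear (fun u : dual_bundle A p => ((H p u, u) : courant_fiber A p)).
Proof. by move=> a u v; rewrite linearP. Qed.

Definition graph_map p := linfun (fun u : dual_bundle A p =>
  ((H p u, u) : courant_fiber A p)).

Lemma graph_mapE p (u : dual_bundle A p) : graph_map p u = (H p u, u).
Proof.
pose f : {linear dual_bundle A p -> courant_fiber A p} :=
  HB.pack (fun u : dual_bundle A p => ((H p u, u) : courant_fiber A p))
    (GRing.isLinear.Build _ _ _ _ _ (@graph_map_linear p)).
exact: (lfunE f).
Qed.

Lemma mem_graph p (v : courant_fiber A p) : v \in graph_bundle H p <-> v.1 = H p v.2.
Proof.
split=> [/memv_imgP[u _ ->]|e]; first by rewrite -/(graph_map p) graph_mapE.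
apply/memv_imgP; exists v.2; first exact: memvf.
by rewrite -/(graph_map p) graph_mapE -e; case: v {e}.
Qed.

(** The images of a dual frame form a frame, as graph(H) is the injective image
    of the dual bundle. *)
Lemma graph_is_subbundle : is_subbundle (graph_bundle H).
Proof.
exists r => p; have [i ip] := vb_cover A p.
have sf a : smooth_sec_on (A := dual_bundle A) (vb_dom i) (fun q => tnth
  (dual_frame i q) a).
  exact: (@smooth_frame _ _ _ _ (dual_bundle A) i a).
exists (vb_dom i), (fun a q => H q (tnth (dual_frame i q) a)),
  (fun a q => tnth (dual_frame i q) a); split => //; first exact: vb_dom_open.
  by move=> a; split; [apply: bmap_smooth; [exact: vb_dom_open|exact: sf]|exact: sf].
move=> q iq; have k0 : lker (graph_map q) = 0%VS.
  apply/eqP; rewrite -subv0; apply/subvP => u; rewrite memv_ker graph_mapE memv0.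
  by move=> /eqP[_ ->].
rewrite /graph_bundle -/(graph_map q).
have kf : (fullv :&: lker (graph_map q) = 0)%VS by rewrite k0 capv0.
have := limg_basis_of kf (dual_frame_basis iq).
congr basis_of; rewrite -[in LHS](map_tnth_enum (dual_frame i q)) -map_comp /=.
by apply: eq_map => a /=; rewrite graph_mapE.
Qed.

Definition fiber_skew := forall p (u v : dual_bundle A p),
  (u : 'Hom(A p, R^o)) (H p v) = - (v : 'Hom(A p, R^o)) (H p u).

(** Isotropy of graph(H) is skewness of H.  Maximality is then automatic: if
    (a, u) is orthogonal to graph(H), then x(a) = - u(H x) = x(H u) for every
    covector x, so a = H u. *)
Lemma graph_maximally_isotropic : maximally_isotropic (graph_bundle H) <-> fiber_skew.
Proof.
split=> [mi p u v|sk p].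
  have [iso _] := mi p.
  have := iso (H p v, v) (H p u, u); rewrite /courant_pairing /= => e.
  have {}e := e ((mem_graph (p := p) (H p v, v)).2 erefl) ((mem_graph (p := p)
    (H p u, u)).2 erefl).
  by apply/eqP; rewrite -addr_eq0 addrC; move/eqP: e;
    rewrite mulf_eq0 invr_eq0 pnatr_eq0.
have iso : isotropic (graph_bundle H p).
  move=> [a u] [b v] /mem_graph/= -> /mem_graph/= ->.
  by rewrite /courant_pairing /= sk addNr mulr0.
split=> // W iW gW; apply/eqP; rewrite eqEsubv gW andbT; apply/subvP => -[a u] Wau.
apply/mem_graph => /=; apply: fiber_sep => x; set v := x p.
have gv : (H p v, v) \in W by apply: (subvP gW); exact/mem_graph.
have := iW _ _ gv Wau; rewrite /courant_pairing /= => /eqP.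
rewrite mulf_eq0 invr_eq0 pnatr_eq0 /= (sk p u v).
by rewrite subr_eq0 => /eqP.
Qed.

Definition bmap_sec x : section A := Section (bmap_smooth H openT (sec_smooth x)).

Lemma in_graph e : in_sections (graph_bundle H) e <-> e.1 = bmap_sec e.2.
Proof.
split=> [h|h p]; last by apply/mem_graph; rewrite /= h.
by apply: sec_inj => p; exact: ((mem_graph _).1 (h p)).
Qed.

Lemma bmap_sec_lin f x y : bmap_sec (f *: x + y) = f *: bmap_sec x + bmap_sec y.
Proof. by apply: sec_inj => p /=; rewrite linearP. Qed.

Lemma fiber_skewP : fiber_skew <->
  forall x y, pairing x (bmap_sec y) = - pairing y (bmap_sec x).
Proof.
split=> [sk x y|sk p u v]; first by apply: cfun_inj => p; exact: sk.
have [x <-] := section_through u; have [y <-] := section_through v.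
by have := congr1 (fun f : Cinfty M => f p) (sk x y).
Qed.

End Graph.

(** * The Maurer-Cartan equation *)

Section MaurerCartan.
Variables (R : realType) (n : nat) (M : manifold R n) (phi : diffeo M) (r : nat).
Variables (A : vbundle M r) (B : hom_lie_bialgebroid phi A).
Variables (H : bmap (dual_bundle A) A) (pi : kform (dual_bundle A)).
Hypotheses (kpi : is_kform 2 pi) (pi_sharp : is_sharp pi H).
Hypothesis pi_twist : twist_multi B pi = pi.
Implicit Types (x y z : section (dual_bundle A)).

Local Notation tw := (twist (LAd B)).
Local Notation Hs := (bmap_sec H).

Definition maurer_cartan : kform (dual_bundle A) :=
  algd_diff (LAd B) pi + kform_scale (csm M 2^-1) (schouten B pi pi).

Lemma pairing_sharp x y : pairing y (Hs x) = pi [:: x; y].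
Proof. by apply: cfun_inj => p; exact: pi_sharp. Qed.

Lemma sharp_bmap x : sharp pi x = Hs x.
Proof. by apply: pairing_injr => y; rewrite sharpE// pairing_sharp. Qed.

Lemma pi_tw x y : pi [:: tw x; tw y] = pull phi (pi [:: x; y]).
Proof. by rewrite -{1}pi_twist /twist_multi /dagger /= !twistK. Qed.

Lemma bmap_sec_twist x : twist (LA B) (Hs x) = Hs (tw x).
Proof.
apply: pairing_injr => y; rewrite -(twist_invK (LAd B) y) pairing_twist.
by rewrite !pairing_sharp pi_tw.
Qed.

(** The sum of d pi (x, y, z) in the untwisted algebroid A^* and of the three
    cyclic terms of 1/2 [pi, pi] (x, y, z) in the untwisted algebroid A. *)
Definition courant_defect x y z : Cinfty M :=
  uact (LAd B) x (pi [:: y; z]) - uact (LAd B) y (pi [:: x; z])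
  + uact (LAd B) z (pi [:: x; y])
  - pi [:: ubr (LAd B) x y; z] + pi [:: ubr (LAd B) x z; y]
  - pi [:: ubr (LAd B) y z; x]
  + (pairing x (ubr (LA B) (Hs y) (Hs z)) + uact (LA B) (Hs x) (pi [:: z; y]))
  + (pairing y (ubr (LA B) (Hs z) (Hs x)) + uact (LA B) (Hs y) (pi [:: x; z]))
  + (pairing z (ubr (LA B) (Hs x) (Hs y)) + uact (LA B) (Hs z) (pi [:: y; x])).

(** As pi is invariant, twisted arguments turn every twist in the equation into
    a single pull-back. *)
Lemma maurer_cartan_twist x y z :
  maurer_cartan [:: tw x; tw y; tw z] = pull phi (courant_defect x y z).
Proof.
rewrite /maurer_cartan kformDE algd_diff_2E -/(twist_multi B pi) pi_twist.
rewrite !ubr_twist !pi_tw !uact_twist /kform_scale.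
have -> : schouten B pi pi [:: tw x; tw y; tw z]
    = pull phi (uS B (schouten B) pi pi [:: x; y; z]) by rewrite /uS /undagger ipullK.
rewrite (uS_twosections (schoutenP B) _ _ _ kpi kpi) /schouten_formula !sharp_bmap.
rewrite -(pull_csm phi) -(pullM phi) -!(pullN phi) -!(pullD phi); congr pull.
(* on the diagonal the polarised formula has each term twice, whence the 1/2 *)
pose cyc a b c := pairing a (ubr (LA B) (Hs b) (Hs c)) + uact (LA B) (Hs a)
  (pi [:: c; b]).
rewrite (_ : csm M 2^-1 * _ = cyc x y z + cyc y z x + cyc z x y).
  by rewrite /courant_defect /cyc; ring.
rewrite -[RHS]csm_half /cyc; congr (_ * _); ring.
Qed.

(** By skewness <tw z, H u> = - <u, H (tw z)>, so the defect becomes the pairing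
    of the product of two elements of the graph with a third, and every term is
    one of the untwisted expressions above. *)
Lemma pairing_dorfman x y z :
  pairing (tw z) ((dorfman B (Hs x, x) (Hs y, y)).1
     - Hs (dorfman B (Hs x, x) (Hs y, y)).2) = pull phi (courant_defect x y z).
Proof.
rewrite -[- Hs _]scaleN1r pairingDr pairingZr pairing_sharp (kform2_skew kpi).
rewrite -pairing_sharp -bmap_sec_twist mulN1r opprK /dorfman /=.
rewrite -!scaleN1r !(pairingDr, pairingDl, pairingZr, pairingZl).
rewrite pairing_lie_vec pairing_interior_vec pairing_lie_covec pairing_interior_covec.
rewrite -!twist_ubr !pairing_twist !pairing_sharp.
rewrite !mulN1r -!(pullN phi) -!(pullD phi); congr pull; rewrite /courant_defect.
rewrite (kform2_skew kpi z y) (kform2_skew kpi z x) (kform2_skew kpi y x) !uactN.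
rewrite (kform2_skew kpi _ (ubr _ x y)) (kform2_skew kpi _ (ubr _ x z))
  (kform2_skew kpi _ (ubr _ y z)).
rewrite [ubr (LA B) (Hs z) (Hs x)]ubr_skew -scaleN1r pairingZr.
ring.
Qed.

Lemma courant_defect_skew x y z : courant_defect y x z = - courant_defect x y z.
Proof.
have piNl u v : pi [:: - u; v] = - pi [:: u; v].
  by rewrite !(kform2_skew kpi _ v) -!pairing_sharp -scaleN1r pairingZl mulN1r.
rewrite /courant_defect (ubr_skew (LAd B) y x) piNl (ubr_skew (LA B) (Hs z) (Hs y)).
rewrite (ubr_skew (LA B) (Hs y) (Hs x)) (ubr_skew (LA B) (Hs x) (Hs z)).
rewrite -!scaleN1r !pairingZr.
rewrite (kform2_skew kpi z y) (kform2_skew kpi z x) (kform2_skew kpi y x) !uactN.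
ring.
Qed.

(** The Courant bracket is half the difference of two Dorfman products, whose
    defects are opposite because the defect is alternating in x and y. *)
Lemma pairing_courant_bracket x y z :
  pairing (tw z) ((courant_bracket B (Hs x, x) (Hs y, y)).1
     - Hs (courant_bracket B (Hs x, x) (Hs y, y)).2)
  = maurer_cartan [:: tw x; tw y; tw z].
Proof.
have bD u v : Hs (u + v) = Hs u + Hs v by rewrite -{1}[u]scale1r bmap_sec_lin scale1r.
have b0 : Hs 0 = 0 by apply: addr_idem0; rewrite -bD addr0.
have bZ f u : Hs (f *: u) = f *: Hs u by rewrite -[f *: u]addr0 bmap_sec_lin b0 addr0.
have := pairing_dorfman y x z; have := pairing_dorfman x y z; rewrite /courant_bracket.
move: (dorfman B (Hs x, x) (Hs y, y)) (dorfman B (Hs y, y) (Hs x, x)) => d12 d21 /=.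
rewrite -!scaleN1r !bZ !bD !bZ !(pairingDr, pairingZr) => e12 e21.
have skew : pull phi (courant_defect x y z) = - pull phi (courant_defect y x z).
  by rewrite courant_defect_skew pullN.
by rewrite maurer_cartan_twist -[RHS]csm_half {2}skew -e12 -e21; ring.
Qed.

Lemma graph_integrableP :
  (forall e1 e2, in_sections (graph_bundle H) e1 -> in_sections (graph_bundle H) e2 ->
     in_sections (graph_bundle H) (courant_bracket B e1 e2)) <-> maurer_cartan = 0.
Proof.
split=> [int|mc [X x] [Y y] /in_graph/= -> /in_graph/= ->].
  apply: kformP => s; have [/eqP|s3] := boolP (size s == 3%N); last first.
    have [S0 _ _] := schouten_form (schoutenP B) kpi kpi; case: kpi => pi0 _ _.
    by rewrite /maurer_cartan kformDE (algd_diff_degree _ pi0 s3) /kform_scale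
      S0// mulr0 addr0.
  case: s => [|x [|y [|z []]]] //= _.
  rewrite -(twist_invK (LAd B) x) -(twist_invK (LAd B) y) -(twist_invK (LAd B) z).
  rewrite -pairing_courant_bracket.
  have /in_graph <- := int _ _ ((in_graph H (Hs (twist_inv (LAd B) x), twist_inv
    (LAd B) x)).2 erefl)
     ((in_graph H (Hs (twist_inv (LAd B) y), twist_inv (LAd B) y)).2 erefl).
  by rewrite subrr; apply: addr_idem0; rewrite -pairingDr addr0.
apply/in_graph; apply/eqP; rewrite -subr_eq0; apply/eqP; apply: pairing_injr => z.
rewrite -(twist_invK (LAd B) z) pairing_courant_bracket mc.
by apply/esym; apply: addr_idem0; rewrite -pairingDr addr0.
Qed.

End MaurerCartan.

Unset Implicit Arguments.
Theorem theorem4p2 (R : realType) (n : nat) (M : manifold R n) (phi : diffeo M)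
    (r : nat) (A : vbundle M r) (B : hom_lie_bialgebroid phi A)
    (H : bmap (dual_bundle A) A) :
  is_hom_dirac B (graph_bundle H) <->
  exists pi : kform (dual_bundle A),
    [/\ is_kform 2 pi,
        twist_multi B pi = pi,
        is_sharp pi H
      & algd_diff (LAd B) pi + kform_scale (csm M 2^-1) (schouten B pi pi) = 0].
Proof.
split=> [[_ /graph_maximally_isotropic/fiber_skewP sk int tw_inv]|[pi [kpi pi_tw
  pi_sh mc]]].
  pose pi := kform2 (fun x y => pairing y (bmap_sec H x)).
  have kpi : is_kform 2 pi.
    apply: is_kform2 => [f x y z|f x y z|x].
    - by rewrite bmap_sec_lin pairing_sec_lin.
    - exact: pairing_vec_lin.
    - have := sk x x => /eqP; rewrite -addr_eq0 => /eqP e.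
      by rewrite -[LHS]csm_half e mulr0.
  have pi_sh : is_sharp pi H by [].
  have tw_sec x : twist (LA B) (bmap_sec H x) = bmap_sec H (twist (LAd B) x).
    exact: ((in_graph H (courant_twist B (bmap_sec H x, x))).1
      (tw_inv _ ((in_graph H (bmap_sec H x, x)).2 erefl))).
  have pi_tw : twist_multi B pi = pi.
    apply: kformP => s; rewrite /twist_multi /dagger /pi.
    case: s => [|x [|y [|z s]]] /=; rewrite ?pull0//.
    by rewrite -(pairing_twist B) tw_sec !twist_invK.
  exists pi; split => //; exact/(graph_integrableP kpi pi_sh pi_tw).
have sk x y : pairing x (bmap_sec H y) = - pairing y (bmap_sec H x).
  by rewrite !(pairing_sharp pi_sh) (kform2_skew kpi).
split.
- exact: graph_is_subbundle.
- by apply/graph_maximally_isotropic/fiber_skewP.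
- exact/(graph_integrableP kpi pi_sh pi_tw).
- move=> [X x] /in_graph/= ->; apply/in_graph => /=.
  exact: (bmap_sec_twist pi_sh pi_tw).
Qed.
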